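(* Let $k$ be an algebraically closed field and $n\ge1$. The maximum size of a set of mutually compatible band bricks over $\Lambda_n$ from pairwise distinct one-parameter families is $\lceil (n-1)/2\rceil$.
   Context: The algebra $\Lambda_n$. $Q_n$ is the quiver with vertices $1,\dots,n$ and, for each $1\le i\le n-1$, two arrows $\alpha_i,\beta_i:i+1\to i$. $R_n=\{\alpha_i\beta_{i+1},\ \beta_i\alpha_{i+1}:1\le i\le n-2\}$ (paths composed right to left), $\Lambda_n=kQ_n/(R_n)$; modules are finite-dimensional left modules, i.e. representations of $(Q_n,R_n)$. Band modules. A walk $z=\gamma_r\cdots\gamma_1$ is a sequence of arrows or formal inverses of arrows (source and target exchanged), the target of $\gamma_s$ being the source of $\gamma_{s+1}$; $\gamma_s$ goes from $v_{s-1}$ to $v_s$. It is a string walk if $\gamma_{s+1}\ne\gamma_s^{-1}$ and neither $\gamma_{s+1}\gamma_s$ nor its inverse is in $R_n$, for all $s$. A band walk is a string walk of positive length with $v_0=v_r$, not a proper power of another walk, all of whose powers are string walks. For a band walk $z$ and $\lambda\in k^\times$, $B_{z,1,\lambda}$ has basis $\epsilon_0,\dots,\epsilon_{r-1}$ with $\epsilon_s$ at vertex $v_s$ (and $\epsilon_r=\epsilon_0$); if $\gamma_s=\gamma$ is an arrow then $\gamma\epsilon_{s-1}=\epsilon_s$ for $s<r$ and $\gamma\epsilon_{r-1}=\lambda\epsilon_r$ for $s=r$; if $\gamma_s=\gamma^{-1}$ then $\gamma\epsilon_s=\epsilon_{s-1}$ for $s<r$ and $\gamma\epsilon_r=\lambda^{-1}\epsilon_{r-1}$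 for $s=r$; all other actions of arrows are zero. More generally $B_{z,m,\lambda}$ ($m\ge1$) is obtained by replacing each $k\epsilon_s$ by $k^m$, the scalars $1$ by identity matrices and $\lambda$ (resp. $\lambda^{-1}$) by a Jordan block of size $m$ with that eigenvalue. The modules $B_{z,m,\lambda}$ are the band modules. A brick is a module with endomorphism ring $k$; a band brick is a band module that is a brick (it is then of the form $B_{z,1,\lambda}$). Two bricks $B,B'$ are compatible if $\mathrm{Hom}(B,B')=0=\mathrm{Hom}(B',B)$. The one-parameter family of $B_{z,1,\lambda}$ is $\{B_{z,1,\mu}:\mu\in k^\times\}$, considered up to isomorphism of its members (i.e. $z$ up to cyclic conjugation and inversion). *)

(* Defs.v *)
From mathcomp Require Import all_boot all_order all_algebra.
From mathcomp Require Import all_classical.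

Set Implicit Arguments.
Unset Strict Implicit.
Unset Printing Implicit Defensive.

Import GRing.Theory.
Local Open Scope ring_scope.

(* The quiver Q_n.  Vertices and arrow indices are shifted to start from 0:
   the vertices are 'I_n, and for i < n - 1 there are two arrows
   alpha_i = (i, false) and beta_i = (i, true) from i + 1 to i. *)

Definition arrow (n : nat) : Type := ('I_n.-1 * bool)%type.

Lemma arrow_src_subproof (n : nat) (i : 'I_n.-1) : (i.+1 < n)%N.
Proof. by case: n i => [|n] [i]. Qed.

Lemma arrow_tgt_subproof (n : nat) (i : 'I_n.-1) : (i < n)%N.
Proof. exact: ltn_trans (ltnSn i) (arrow_src_subproof i). Qed.

Definition src (n : nat) (a : arrow n) : 'I_n :=
  Ordinal (arrow_src_subproof a.1).
Definition tgt (n : nat) (a : arrow n) : 'I_n :=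
  Ordinal (arrow_tgt_subproof a.1).

(* The path a b ("first b, then a") is one of the zero relations
   alpha_i beta_(i+1), beta_i alpha_(i+1). *)
Definition in_R (n : nat) (a b : arrow n) : bool :=
  (b.1 == a.1.+1 :> nat) && (a.2 != b.2).

(* A finite-dimensional left module over Lambda_n = k Q_n / (R_n), with
   underlying space of column vectors k^d, given by the left actions of the
   generators of the path algebra: the trivial paths e_v and the arrows.
   The representation space at v is the image of e_v. *)
Record lambda_module (k : fieldType) (n : nat) := LambdaModule {
  mdim : nat;
  idem : 'I_n -> 'M[k]_mdim;
  act : arrow n -> 'M[k]_mdim;
  idemM : forall v w, idem v *m idem w = if v == w then idem v else 0;
  idem_sum : \sum_v idem v = 1%:M;
  act_src : forall a, act a *m idem (src a) = act a;
  act_tgt : forall a, idem (tgt a) *m act a = act a;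
  act_rel : forall a b, in_R a b -> act a *m act b = 0
}.

Definition is_hom (k : fieldType) (n : nat) (M N : lambda_module k n)
    (X : 'M[k]_(mdim N, mdim M)) : Prop :=
  (forall v, X *m idem M v = idem N v *m X) /\
  (forall a, X *m act M a = act N a *m X).

Definition mod_iso (k : fieldType) (n : nat) (M N : lambda_module k n) : Prop :=
  exists X Y, [/\ is_hom (M := M) (N := N) X, is_hom (M := N) (N := M) Y,
                  Y *m X = 1%:M & X *m Y = 1%:M].

Definition brick (k : fieldType) (n : nat) (M : lambda_module k n) : Prop :=
  (0 < mdim M)%N /\
  forall X, is_hom (M := M) (N := M) X -> exists c : k, X = c%:M.

Definition compatible (k : fieldType) (n : nat) (M N : lambda_module k n) :
    Prop :=
  (forall X, is_hom (M := M) (N := N) X -> X = 0) /\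
  (forall X, is_hom (M := N) (N := M) X -> X = 0).

(* (a, false) is the arrow a and (a, true) is its formal inverse. *)
Definition letter (n : nat) : Type := (arrow n * bool)%type.

Definition lsrc (n : nat) (g : letter n) : 'I_n :=
  if g.2 then tgt g.1 else src g.1.
Definition ltgt (n : nat) (g : letter n) : 'I_n :=
  if g.2 then src g.1 else tgt g.1.
Definition linv (n : nat) (g : letter n) : letter n := (g.1, ~~ g.2).

(* "h g or its inverse is in R_n", where g is traversed first. *)
Definition forbidden (n : nat) (g h : letter n) : bool :=
  [&& ~~ g.2, ~~ h.2 & in_R h.1 g.1] || [&& g.2, h.2 & in_R g.1 h.1].

Definition composable (n : nat) (g h : letter n) : bool := ltgt g == lsrc h.

Definition string_step (n : nat) (g h : letter n) : bool :=
  [&& composable g h, h != linv g & ~~ forbidden g h].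

(* The walk gamma_r ... gamma_1 is the sequence [:: gamma_1; ...; gamma_r],
   in order of traversal.  The empty sequence satisfies both predicates. *)
Definition is_walk (n : nat) (z : seq (letter n)) : bool :=
  sorted (@composable n) z.
Definition is_string (n : nat) (z : seq (letter n)) : bool :=
  sorted (@string_step n) z.

Definition wpow (n : nat) (z : seq (letter n)) (j : nat) : seq (letter n) :=
  flatten (nseq j z).

Definition closed_walk (n : nat) (z : seq (letter n)) : bool :=
  if z is g :: z' then lsrc g == ltgt (last g z') else true.

Definition is_band (n : nat) (z : seq (letter n)) : Prop :=
  [/\ (0 < size z)%N, is_string z, closed_walk z,
      ~ (exists w j, [/\ is_walk w, (1 < j)%N & z = wpow w j])
    & forall j, is_string (wpow z j)].

Record band_walk (n : nat) := BandWalk {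
  bw_seq :> seq (letter n);
  bw_band : is_band bw_seq
}.

Definition jordan_block (k : fieldType) (m : nat) (lam : k) : 'M[k]_m :=
  \matrix_(i < m, j < m)
    (if i == j then lam else if j == i.+1 :> nat then 1 else 0).

Section BandModule.

Variables (k : fieldType) (n : nat) (z : band_walk n) (m : nat) (lam : k).

(* For s : 'I_(size z), gam s is gamma_(s+1), going from v_s to v_(s+1); the
   index s + 1 is taken modulo r = size z by ordS, so that s = r - 1 is the
   position where lam enters. *)
Let gam (s : 'I_(size z)) : letter n := tnth (in_tuple z) s.
Let wrap (s : 'I_(size z)) : bool := s.+1 == size z.

Definition band_vertex (s : 'I_(size z)) : 'I_n := lsrc (gam s).

Definition band_idem (v : 'I_n) : 'M[k]_(\sum_(s < size z) m) :=
  \mxdiag_(s < size z) (if band_vertex s == v then 1%:M else 0 : 'M[k]_m).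

(* The block of the arrow a from the copy of k^m at epsilon_j to the copy at
   epsilon_i. *)
Definition band_block (a : arrow n) (i j : 'I_(size z)) : 'M[k]_m :=
  if (gam j == (a, false)) && (i == ordS j) then
    if wrap j then jordan_block m lam else 1%:M
  else if (gam i == (a, true)) && (j == ordS i) then
    if wrap i then jordan_block m lam^-1 else 1%:M
  else 0.

Definition band_act (a : arrow n) : 'M[k]_(\sum_(s < size z) m) :=
  \mxblock_(i < size z, j < size z) band_block a i j.

Lemma band_step (s : 'I_(size z)) : string_step (gam s) (gam (ordS s)).
Proof.
have [z0 _ _ _ /(_ 2%N)] := bw_band z.
rewrite /is_string /wpow /= cats0.
have g0 : letter n by exact: gam s.
move=> /(sortedP g0) /(_ s).
rewrite size_cat !nth_cat ltn_ord => /(_ _).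
rewrite /gam !(tnth_nth g0) /=.
have := ltn_ord s; rewrite leq_eqVlt => /orP[/eqP e|lt_s].
  rewrite e ltnn subnn modnn; apply.
  by rewrite -{1}(addn0 (size z)) ltn_add2l.
by rewrite lt_s modn_small //; apply; apply: ltn_addr.
Qed.

Lemma band_vertexS (s : 'I_(size z)) : band_vertex (ordS s) = ltgt (gam s).
Proof. by have /and3P[/eqP] := band_step s. Qed.

Lemma band_idemM (v w : 'I_n) :
  band_idem v *m band_idem w = if v == w then band_idem v else 0.
Proof.
rewrite /band_idem [X in _ *m X]/mxdiag mul_mxdiag_mxblock.
have -> : (if v == w then band_idem v else 0) = \mxdiag_(s < size z)
    (if (v == w) && (band_vertex s == v) then 1%:M else 0 : 'M[k]_m).
  by case: (v == w); rewrite // mxdiag0.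
apply: eq_mxblock => i j; case: (eqVneq i j) => [->|_]; last by rewrite mulmx0.
rewrite !conform_mx_id; case: (eqVneq v w) => [<-|ne_vw] /=.
  by case: ifP => _; rewrite ?mul1mx ?mul0mx.
case: eqVneq => [->|_]; last by rewrite mul0mx.
by rewrite (negPf ne_vw) mulmx0.
Qed.

Lemma band_idem_sum : \sum_v band_idem v = 1%:M.
Proof.
rewrite /band_idem -mxdiag_sum -mxdiagZ; apply: eq_mxdiag => s.
rewrite (bigD1 (band_vertex s)) //= eqxx big1 ?addr0 // => v.
by rewrite eq_sym => /negPf ->.
Qed.

Lemma band_act_src (a : arrow n) : band_act a *m band_idem (src a) = band_act a.
Proof.
rewrite /band_act /band_idem mul_mxblock_mxdiag; apply: eq_mxblock => i j.
have [_|ne] := eqVneq; first by rewrite mulmx1.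
rewrite mulmx0 /band_block; case: andP => [[/eqP gj _]|_].
  by rewrite /band_vertex gj eqxx in ne.
by case: andP => // -[/eqP gi /eqP ej]; rewrite ej band_vertexS gi eqxx in ne.
Qed.

Lemma band_act_tgt (a : arrow n) : band_idem (tgt a) *m band_act a = band_act a.
Proof.
rewrite /band_act /band_idem mul_mxdiag_mxblock; apply: eq_mxblock => i j.
have [_|ne] := eqVneq; first by rewrite mul1mx.
rewrite mul0mx /band_block; case: andP => [[/eqP gj /eqP ei]|_].
  by rewrite ei band_vertexS gj eqxx in ne.
by case: andP => // -[/eqP gi _]; rewrite /band_vertex gi eqxx in ne.
Qed.

Lemma band_act_rel (a b : arrow n) :
  in_R a b -> band_act a *m band_act b = 0.
Proof.
move=> ab; rewrite /band_act mul_mxblock -mxblock0; apply: eq_mxblock => i j.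
rewrite big1 // => l _; rewrite /band_block.
case: (boolP (_ && (i == _))) => [/andP[/eqP gl /eqP _]|_]; last first.
  case: (boolP (_ && (l == ordS i))) => [/andP[/eqP gi /eqP el]|_]; last first.
    by rewrite mul0mx.
  case: (boolP (_ && (l == ordS j))) => [/andP[/eqP gj /eqP el']|_].
    have ij : i = j by apply: ordS_inj; rewrite -el -el'.
    by rewrite ij gj in gi.
  case: (boolP (_ && (j == ordS l))) => [/andP[/eqP gl /eqP _]|_]; last first.
    by rewrite mulmx0.
  by have /and3P[_ _] := band_step i; rewrite -el gi gl /forbidden /= ab.
case: (boolP (_ && (l == ordS j))) => [/andP[/eqP gj /eqP el]|_].
  by have /and3P[_ _] := band_step j; rewrite -el gj gl /forbidden /= ab.
by rewrite gl xpair_eqE andbF /= mulmx0.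
Qed.

Definition band_module : lambda_module k n :=
  LambdaModule band_idemM band_idem_sum band_act_src band_act_tgt band_act_rel.

End BandModule.

Definition is_band_module (k : fieldType) (n : nat) (M : lambda_module k n) :
    Prop :=
  exists (z : band_walk n) (m : nat) (lam : k),
    [/\ (0 < m)%N, lam != 0 & mod_iso M (band_module z m lam)].

Definition band_brick (k : fieldType) (n : nat) (M : lambda_module k n) :
    Prop :=
  is_band_module M /\ brick M.

(* The one-parameter family of the modules B_(z,1,mu), closed under
   isomorphism. *)
Definition band_family (k : fieldType) (n : nat) (z : band_walk n) :
    set (lambda_module k n) :=
  [set M | exists2 mu : k, mu != 0 & mod_iso M (band_module z 1 mu)]%classic.

Definition distinct_families (k : fieldType) (n : nat)
    (M N : lambda_module k n) : Prop :=
  forall z z' : band_walk n, band_family z M -> band_family z' N ->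
    band_family (k := k) z <> band_family z'.

(* Members of S in distinct families are never isomorphic, so the cardinality
   of S counts isomorphism classes. *)
Definition compatible_band_bricks (k : fieldType) (n : nat)
    (S : set (lambda_module k n)) : Prop :=
  (forall M, S M -> band_brick M) /\
  (forall M N, S M -> S N -> M <> N ->
     compatible M N /\ distinct_families M N).

(* Main.v *)
(* Up to inversion, the alphas of a band go down and its betas go up, so a band
   is a primitive closed lattice path h with values in {0, ..., n - 1}.  The
   graph maps show that the bands of compatible bricks, as well as a single one
   with itself, cross whenever they meet: two stretches U w D and D w U at the
   same heights would give a nonzero homomorphism.

   Order the positions at a given height by the height of their future at the
   first divergence; the crossing condition says that this is also the order by
   depth of the past.  Give weights c_j to the paths, let A_w be the weighted
   number of rises from w to w + 1, and let rank be the weight of the preceding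
   positions.  The steps act on ranks like an interval exchange: a rise leaves
   the rank unchanged, and a fall to w adds A_(w-1) - A_(w+1) to it.  Summing
   around a path shows that the vectors of rises are pairwise orthogonal for the
   skew form of a linear quiver with n - 1 vertices, whose kernel has dimension
   at most 1.  They are also linearly independent, because the exchange, hence
   the set of its orbits, is determined by the A_w.  So there are at most n / 2
   of them.  The Kronecker bands on the vertices 2 i and 2 i + 1 reach this
   bound. *)

Require Import Defs.
From mathcomp Require Import all_boot all_order all_algebra.
From mathcomp Require Import all_classical.
From mathcomp Require Import zify ring lra.

Set Implicit Arguments.
Unset Strict Implicit.
Unset Printing Implicit Defensive.

Import Order.TTheory GRing.Theory Num.Theory.

Local Open Scope classical_set_scope.
Local Open Scope card_scope.
Local Open Scope ring_scope.

(** * Crossing closed paths *)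

Definition unit_steps (h : nat -> nat) : Prop :=
  forall p, h p.+1 = (h p).+1 \/ h p = (h p.+1).+1.

Definition future (h : nat -> nat) (p : nat) : nat -> nat := fun i => h (p + i)%N.

(** Lexicographic order in which the higher sequence comes first. Sequences with different heads are
    incomparable. *)
Definition prec (s t : nat -> nat) : Prop :=
  exists i, (forall j, (j <= i)%N -> s j = t j) /\ (t i.+1 < s i.+1)%N.

Lemma prec_trans s t u : prec s t -> prec t u -> prec s u.
Proof.
move=> [i [eqi lti]] [j [eqj ltj]]; exists (minn i j); split=> [l|].
  by rewrite leq_min => /andP[li lj]; rewrite eqi // eqj.
have [ij|ij|ij] := ltngtP i j.
- by rewrite -eqj.
- by rewrite eqi.
- by rewrite -ij in ltj; apply: ltn_trans ltj lti.
Qed.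

Lemma prec_irr s : ~ prec s s.
Proof. by move=> [i [_]]; rewrite ltnn. Qed.

Lemma prec_head s t : prec s t -> s 0%N = t 0%N.
Proof. by move=> [i [+ _]]; apply. Qed.

Lemma precS s t : s 0%N = t 0%N -> s 1%N = t 1%N ->
  prec s t <-> prec (fun i => s i.+1) (fun i => t i.+1).
Proof.
move=> e0 e1; split=> [[[|i] [eqi lti]]|[i [eqi lti]]].
- by rewrite e1 ltnn in lti.
- by exists i; split=> // j ji; apply: eqi.
- by exists i.+1; split=> // -[|j] // ji; apply: eqi.
Qed.

Lemma sum_periodic (V : nmodType) (r : nat) (F : nat -> V) :
  F r = F 0%N -> \sum_(p < r) F p.+1 = \sum_(p < r) F p.
Proof.
case: r => [|r] Fr; first by rewrite !big_ord0.
by rewrite big_ord_recr big_ord_recl /= Fr addrC.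
Qed.

Section CrossingPaths.

Variables (m n : nat) (r : 'I_m -> nat) (h : 'I_m -> nat -> nat).
Hypothesis r_gt0 : forall j, (0 < r j)%N.
Hypothesis h_per : forall j p, h j (p + r j)%N = h j p.
Hypothesis h_step : forall j, unit_steps (h j).
Hypothesis h_lt : forall j p, (h j p < n)%N.
(** The stretch U w D belongs to [j] and D w U to [j']. The case [j = j'] is included; it will come
    from the brick condition. *)
Hypothesis h_cross : forall j j' p q l,
  h j p.+1 = (h j p).+1 -> h j' q = (h j' q.+1).+1 ->
  (forall i, (i <= l)%N -> h j (p.+1 + i)%N = h j' (q.+1 + i)%N) ->
  h j (p.+1 + l)%N = (h j (p.+1 + l.+1)%N).+1 ->
  h j' (q.+1 + l.+1)%N = (h j' (q.+1 + l)%N).+1 -> False.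
Hypothesis h_dist : forall j j' p q, j != j' ->
  ~ (forall i, h j (p + i)%N = h j' (q + i)%N).

Lemma h_perM j p c : h j (p + c * r j)%N = h j p.
Proof.
by elim: c => [|c IH]; rewrite ?mul0n ?addn0 // mulSn addnCA addnC h_per.
Qed.

(* By periodicity, two paths with different pasts separate in the future; by
   the crossing hypothesis, the one that entered from below leaves above. *)
Lemma prec_rise_fall j j' p q :
  h j p.+1 = (h j p).+1 -> h j' q = (h j' q.+1).+1 ->
  h j p.+1 = h j' q.+1 -> prec (future (h j) p.+1) (future (h j') q.+1).
Proof.
move=> up dn e0.
have ex : exists i, h j (p.+1 + i)%N != h j' (q.+1 + i)%N.
  exists (r j * r j').-1.
  have E x : (x.+1 + (r j * r j').-1 = x + r j * r j')%N.
    by rewrite addSnnS prednK // muln_gt0 !r_gt0.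
  rewrite !E [in X in _ != X]h_perM mulnC h_perM; lia.
case: (ex_minnP ex) => -[|i]; first by rewrite !addn0 e0 eqxx.
move=> nei mini.
have eqi l : (l <= i)%N -> h j (p.+1 + l)%N = h j' (q.+1 + l)%N.
  by move=> li; apply/eqP/negPn/negP => /mini; rewrite ltnNge li.
exists i; split=> //; rewrite /future.
have := h_step j (p.+1 + i)%N; have := h_step j' (q.+1 + i)%N.
have := eqi i (leqnn i); have := @h_cross j j' p q i up dn eqi.
rewrite !addnS in nei *; lia.
Qed.

Definition rises j (w : nat) : nat :=
  \sum_(p < r j) ((h j p == w) && (h j p.+1 == w.+1)).

Definition falls j (w : nat) : nat :=
  \sum_(p < r j) ((h j p == w.+1) && (h j p.+1 == w)).

(** Each rise from [w] removes one from the indicator of height at most [w] and each fall to [w]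
    adds one, while its sum over a period is invariant under the shift. *)
Lemma rises_falls j w : rises j w = falls j w.
Proof.
have E : (\sum_(p < r j) (h j p.+1 <= w) = \sum_(p < r j) (h j p <= w))%N.
  by apply: (@sum_periodic nat _ (fun p => nat_of_bool (h j p <= w)%N));
     rewrite -(h_per j 0).
rewrite /rises /falls; apply/eqP; rewrite -(eqn_add2l (\sum_(p < r j) (h j p.+1 <= w))).
rewrite {2}E -!big_split /=; apply/eqP; apply: eq_bigr => p _.
have := h_step j p; lia.
Qed.

Lemma rises_out j w : (n <= w.+1)%N -> rises j w = 0%N.
Proof.
move=> nw; rewrite /rises big1 // => p _; have := h_lt j p.+1; lia.
Qed.

(** * Weighted ranks as an interval exchange *)

Section Weights.

Variable c : 'I_m -> rat.

Definition level (w : nat) : rat := \sum_j c j * (rises j w)%:R.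

Definition rank (s : nat -> nat) : rat :=
  \sum_j c j * \sum_(q < r j) `[< prec (future (h j) q) s >]%:R.

(** Pairs every position with its successor, so that the ranks before and after a step can be
    compared term by term. *)
Lemma rankS_sum (s : nat -> nat) :
  rank s = \sum_j c j * \sum_(q < r j) `[< prec (future (h j) q.+1) s >]%:R.
Proof.
apply: eq_bigr => j _; congr (_ * _).
rewrite (@sum_periodic _ _ (fun q => (`[< prec (future (h j) q) s >]%:R : rat))) //.
suff -> : future (h j) (r j) = future (h j) 0 by [].
by apply/funext => i; rewrite /future add0n addnC h_per.
Qed.

Lemma futureS j p : (fun i => future (h j) p i.+1) = future (h j) p.+1.
Proof. by apply/funext => i; rewrite /future addSnnS. Qed.

Lemma prec_step j j' p q : h j p = h j' q -> h j p.+1 = h j' q.+1 ->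
  `[< prec (future (h j) p.+1) (future (h j') q.+1) >]
    = `[< prec (future (h j) p) (future (h j') q) >].
Proof.
move=> e0 e1; apply/asbool_equiv_eq; rewrite -!futureS; apply: iff_sym.
by apply: precS; rewrite /future ?addn0 ?addn1.
Qed.

Lemma prec_neq j j' p q : h j p <> h j' q ->
  `[< prec (future (h j) p) (future (h j') q) >] = false.
Proof.
by move=> ne; apply/asboolPn => /prec_head; rewrite /future !addn0.
Qed.

Lemma prec_gt j j' p q : h j p = h j' q -> (h j' q.+1 < h j p.+1)%N ->
  `[< prec (future (h j) p) (future (h j') q) >].
Proof.
move=> e0 lt1; apply/asboolP; exists 0%N; rewrite /future !addn1; split=> // i.
by rewrite leqn0 => /eqP->; rewrite !addn0.
Qed.

Lemma prec_lt j j' p q : h j p = h j' q -> (h j p.+1 < h j' q.+1)%N ->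
  `[< prec (future (h j) p) (future (h j') q) >] = false.
Proof.
move=> e0 lt1; apply/asboolPn => pr; have := prec_gt (esym e0) lt1.
by move/asboolP => /(prec_trans pr) /prec_irr.
Qed.

(** Positions that fall from the old height come after [p], and positions that enter the new height
    from above come after [p.+1] by [prec_rise_fall]. Neither are counted, and those rising along
    with [p] keep their order. *)
Lemma rank_rise j p : h j p.+1 = (h j p).+1 ->
  rank (future (h j) p.+1) = rank (future (h j) p).
Proof.
move=> up; rewrite rankS_sum; apply: eq_bigr => j' _; congr (_ * _).
apply: eq_bigr => q _; congr (nat_of_bool _)%:R.
have [e1|ne1] := eqVneq (h j' q.+1) (h j p.+1).
  have [eq0|ne0] := eqVneq (h j' q) (h j p); first exact: prec_step.
  rewrite (@prec_neq _ _ q); last exact/eqP.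
  apply/asboolPn => pr; have: prec (future (h j) p.+1) (future (h j') q.+1).
    by apply: prec_rise_fall => //; have := h_step j' q; lia.
  by move/prec_trans => /(_ _ pr) /prec_irr.
rewrite prec_neq; last exact/eqP.
have [e0|/eqP ne0] := eqVneq (h j' q) (h j p); last by rewrite prec_neq.
by rewrite prec_lt //; have := h_step j' q; lia.
Qed.

(** This is [A_(w-1)], with [A_(-1) = 0] because no rise ends at height 0. *)
Definition level_below (w : nat) : rat := if w is w'.+1 then level w' else 0.

Lemma level_belowE w : level_below w =
  \sum_j c j * \sum_(q < r j) (((h j q).+1 == w) && (h j q.+1 == w))%:R.
Proof.
case: w => [|w] /=; last first.
  by apply: eq_bigr => j _; rewrite natr_sum; congr (_ * _); apply: eq_bigr => q _.
by rewrite big1 // => j _; rewrite big1 ?mulr0 // => q _.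
Qed.

(** Positions rising from the old height all precede [p] and drop out of the count; positions rising
    into the new height all precede [p.+1] and join it; those falling along with [p] keep their
    order. *)
Lemma rank_fall j p : h j p = (h j p.+1).+1 ->
  rank (future (h j) p.+1)
    = rank (future (h j) p) + level_below (h j p.+1) - level (h j p.+1).+1.
Proof.
move=> dn; rewrite rankS_sum level_belowE /level /rank -big_split -sumrB.
apply: eq_bigr => j' _; rewrite /= natr_sum -mulrDr -mulrBr; congr (_ * _).
rewrite -big_split -sumrB; apply: eq_bigr => q _ /=.
have st := h_step j' q.
set up := (_ && (h j' q.+1 == h j p.+1)); set out := (_ && (_ == _.+2)).
have [e0|ne0] := eqVneq (h j' q) (h j p).
  have [e1|ne1] := eqVneq (h j' q.+1) (h j p.+1).
    have [-> ->] : up = false /\ out = false by rewrite /up /out; split; lia.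
    by rewrite prec_step // addr0 subr0.
  have [-> ->] : up = false /\ out = true by rewrite /up /out; split; lia.
  rewrite prec_neq; last exact/eqP.
  by rewrite prec_gt ?addr0 ?subrr //; lia.
have -> : out = false by rewrite /out; lia.
rewrite (@prec_neq _ _ q); last exact/eqP.
rewrite add0r subr0; congr (nat_of_bool _)%:R.
have [e1|/eqP ne1] := eqVneq (h j' q.+1) (h j p.+1); last first.
  by rewrite prec_neq // /up; lia.
have -> : up by rewrite /up; lia.
by apply/asboolP; apply: prec_rise_fall => //; lia.
Qed.

(** The rank returns to its value after a period and changes only at falls; the falls to [w] are as
    many as the rises from [w]. *)
Lemma rises_isotropic j :
  \sum_(w < n.-1) (rises j w)%:R * (level_below w - level w.+1) = 0.
Proof.
pose F p := rank (future (h j) p).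
have FS : \sum_(p < r j) (F p.+1 - F p) = 0.
  rewrite sumrB (@sum_periodic _ _ F) ?subrr // /F.
  by congr rank; apply/funext => i; rewrite /future add0n addnC h_per.
rewrite -[RHS]FS.
under eq_bigr => w _ do rewrite rises_falls natr_sum mulr_suml.
rewrite exchange_big; apply: eq_bigr => p _ /=.
have [up|dn] := h_step j p.
  rewrite /F rank_rise // subrr big1 // => w _.
  by rewrite (_ : _ && _ = false) ?mul0r //; lia.
have lt : (h j p.+1 < n.-1)%N by have := h_lt j p; lia.
rewrite (bigD1 (Ordinal lt)) //= big1 ?addr0 => [|w nw].
  by rewrite /F rank_fall // dn !eqxx mul1r; ring.
rewrite (_ : _ && _ = false) ?mul0r //; apply/negP => /andP[_ /eqP ew].
by move/eqP: nw; apply; apply: val_inj.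
Qed.

Hypothesis c_ge0 : forall j, 0 <= c j.

Lemma future_mod j p : future (h j) (p %% r j) = future (h j) p.
Proof.
by apply/funext => i;
  rewrite /future [in RHS](divn_eq p (r j)) -addnA [in RHS]addnC h_perM.
Qed.

(** Whatever precedes a rising position rises as well, and the position itself, of weight [c j], is
    one more rise from this height. *)
Lemma rank_rise_le j p : h j p.+1 = (h j p).+1 ->
  rank (future (h j) p) + c j <= level (h j p).
Proof.
(* Only positions below [r j] occur in the sums, so [p] is moved into the first period. *)
rewrite -(future_mod j p); set p' := (p %% r j)%N => up.
have ep i : h j (p + i) = h j (p' + i).
  by have := congr1 (fun f => f i) (future_mod j p); rewrite /future => <-.
have e0 := ep 0; have e1 := ep 1; rewrite !addn0 !addn1 in e0 e1.
rewrite {}e1 {}e0 in up *.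
have lt_p' : (p' < r j)%N by rewrite ltn_pmod.
have le_term j' (q : nat) : (`[< prec (future (h j') q) (future (h j) p') >] <=
    (h j' q == h j p') && (h j' q.+1 == (h j p').+1))%N.
  have [e0|/eqP ne0] := eqVneq (h j' q) (h j p'); last by rewrite prec_neq.
  have := h_step j' q; have [lt1|] := ltnP (h j' q.+1) (h j p'.+1).
    by rewrite prec_lt.
  by case: `[< _ >] => /=; lia.
rewrite /rank /level (bigD1 j) //= [X in _ <= X](bigD1 j) //= addrAC.
apply: lerD; last first.
  apply: ler_sum => j' _; rewrite ler_wpM2l // -natr_sum ler_nat.
  exact: leq_sum.
rewrite -[X in _ + X]mulr1 -mulrDr ler_wpM2l // -natr_sum natr1 ler_nat.
rewrite (bigD1 (Ordinal lt_p')) //= /rises [leqRHS](bigD1 (Ordinal lt_p')) //=.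
rewrite eqxx up eqxx asboolF ?add0n; last exact: prec_irr.
by rewrite /= add1n ltnS leq_sum.
Qed.

(** All rises from this height precede a falling position. With [rank_rise_le], the level is the cut
    that separates the intervals of rising and of falling positions. *)
Lemma rank_fall_ge j p : h j p = (h j p.+1).+1 ->
  level (h j p) <= rank (future (h j) p).
Proof.
move=> dn; apply: ler_sum => j' _; rewrite ler_wpM2l // -natr_sum ler_nat.
apply: leq_sum => q _; have [e0|//] := eqVneq (h j' q) (h j p).
by case: eqP => // e1; rewrite prec_gt //; lia.
Qed.

(** Descent on the unweighted number [N] of preceding positions: a nonzero rank yields a preceding
    position of positive weight, for which [N] is strictly smaller. *)
Lemma exists_rank0 j p : 0 < c j ->
  exists j' q, [/\ 0 < c j', h j' q = h j p & rank (future (h j') q) = 0].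
Proof.
pose N s := (\sum_j \sum_(q < r j) `[< prec (future (h j) q) s >])%N.
have [k] := ubnP (N (future (h j) p)); elim: k j p => // k IH j p Nk cj.
have [e0|] := eqVneq (rank (future (h j) p)) 0; first by exists j, p.
move=> rk; have [j' [q [cj' pr]]] : exists j' (q : 'I_(r j')),
    0 < c j' /\ prec (future (h j') q) (future (h j) p).
  apply: contrapT => noex; move: rk; rewrite /rank big1 ?eqxx // => j' _.
  have [->|nc] := eqVneq (c j') 0; first by rewrite mul0r.
  rewrite big1 ?mulr0 // => q _; rewrite asboolF // => pr; apply: noex.
  by exists j', q; rewrite lt_def nc c_ge0.
have hq : h j' q = h j p by have := prec_head pr; rewrite /future !addn0.
rewrite ltnS in Nk.
suff /leq_trans /(_ Nk) : (N (future (h j') q) < N (future (h j) p))%N.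
  move=> /IH /(_ cj') [j2 [q2 [c2 h2 r2]]].
  by exists j2, q2; rewrite h2.
have leN j2 (q2 : 'I_(r j2)) : (`[< prec (future (h j2) q2) (future (h j') q) >]
    <= `[< prec (future (h j2) q2) (future (h j) p) >])%N.
  case: asboolP => //= pr2; rewrite asboolT //; exact: prec_trans pr2 pr.
rewrite /N (bigD1 j') //= [ltnRHS](bigD1 j') //= -addSn leq_add //; last first.
  by apply: leq_sum => j2 _; apply: leq_sum.
rewrite (bigD1 q) //= [leqRHS](bigD1 q) //= -addSn leq_add //; last first.
  by apply: leq_sum.
by rewrite asboolF ?asboolT //; apply: prec_irr.
Qed.

End Weights.

(** The exchange depends on the levels only, so [c] and [d] define the same one. If [c] were
    nonzero, then at some height a first position for [c] and one for [d] would both own the point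
    0, and following its orbit would identify two different paths. *)
Lemma level_inj (c d : 'I_m -> rat) :
  (forall j, 0 <= c j) -> (forall j, 0 <= d j) -> (forall j, c j * d j = 0) ->
  level c =1 level d -> forall j, c j = 0.
Proof.
move=> c0 d0 cd lev j; apply/eqP/negPn/negP => cj.
have {}cj : 0 < c j by rewrite lt_def cj c0.
have [w rw] : exists w, (0 < rises j w)%N.
  have [up|dn] := h_step j 0.
    exists (h j 0); rewrite /rises (bigD1 (Ordinal (r_gt0 j))) //=.
    by rewrite up !eqxx.
  exists (h j 1); rewrite rises_falls /falls (bigD1 (Ordinal (r_gt0 j))) //=.
  by rewrite dn !eqxx.
have ex_rise (b : 'I_m -> rat) : (forall j, 0 <= b j) -> 0 < level b w ->
    exists j' p, 0 < b j' /\ h j' p = w.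
  move=> b0 lt0; apply: contrapT => noex; move: lt0.
  rewrite /level big1 ?ltxx // => j' _.
  have [->|nb] := eqVneq (b j') 0; first by rewrite mul0r.
  rewrite /rises big1 ?mulr0 // => p _; case: eqP => // hp.
  by case: noex; exists j', p; split => //; rewrite lt_def nb b0.
have levc : 0 < level c w.
  rewrite /level (bigD1 j) //= ltr_wpDr //.
    by apply: sumr_ge0 => j' _; rewrite mulr_ge0.
  by rewrite mulr_gt0 // ltr0n.
have [jc [pc [jc0 hpc]]] := ex_rise c c0 levc.
have [jd [pd [jd0 hpd]]] : exists j' p, 0 < d j' /\ h j' p = w.
  by apply: ex_rise; rewrite // -lev.
have [j1 [p [c1 hp rp]]] := exists_rank0 c0 pc jc0.
have [j2 [q [d2 hq rq]]] := exists_rank0 d0 pd jd0.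
have ne12 : j1 != j2.
  apply: contraTneq d2 => e12; have /eqP := cd j1.
  by rewrite mulf_eq0 gt_eqF //= e12 => /eqP->; rewrite ltxx.
apply: (h_dist (p := p) (q := q) ne12) => i.
(* The c-interval of the first path and the d-interval of the second one keep a
   common point t, so that the two paths always make the same step. *)
suff : h j1 (p + i) = h j2 (q + i) /\ exists t : rat,
    [/\ rank c (future (h j1) (p + i)) <= t < rank c (future (h j1) (p + i)) + c j1 &
        rank d (future (h j2) (q + i)) <= t < rank d (future (h j2) (q + i)) + d j2].
  by case.
elim: i => [|i [e0 [t [/andP[ct tc] /andP[dt td]]]]].
  rewrite !addn0 hp hq hpc hpd; split=> //; exists 0; rewrite rp rq !add0r lexx.
  by rewrite c1 d2.
rewrite !addnS.
have lev_below w' : level_below c w' = level_below d w'.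
  by case: w' => //= w'; apply: lev.
have [up1|dn1] := h_step j1 (p + i); have [up2|dn2] := h_step j2 (q + i).
- rewrite up1 up2 e0; split=> //; exists t; rewrite !rank_rise //.
  by rewrite ct dt.
(* A rise of one path and a fall of the other would put [t] strictly below the common cut and also
   at or above it. *)
- have le1 := rank_rise_le c0 up1; have := rank_fall_ge d0 dn2.
  rewrite -e0 -lev => le2.
  by have := lt_le_trans tc (le_trans le1 (le_trans le2 dt)); rewrite ltxx.
- have le1 := rank_rise_le d0 up2; have := rank_fall_ge c0 dn1.
  rewrite e0 lev => le2.
  by have := lt_le_trans td (le_trans le1 (le_trans le2 ct)); rewrite ltxx.
- have e1 : h j1 (p + i).+1 = h j2 (q + i).+1.
    by apply: succn_inj; rewrite -dn1 -dn2.
  split=> //; exists (t + level_below c (h j1 (p + i).+1)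
    - level c (h j1 (p + i).+1).+1).
  rewrite !rank_fall // -e1 -lev -lev_below; split; apply/andP; split; lra.
Qed.

(** * Linear independence of the rises and the rank bound *)

Definition rise_mx : 'M[rat]_(m, n.-1) := \matrix_(j, w) (rises j w)%:R.

Lemma level_rise_mx (x : 'rV_m) (w : 'I_n.-1) :
  (x *m rise_mx) 0 w = level (x 0) w.
Proof. by rewrite mxE; apply: eq_bigr => j _; rewrite mxE. Qed.

(** The positive and negative parts of a linear relation are weightings with disjoint supports and
    equal levels, so [level_inj] applies to both. *)
Lemma rise_mx_free : row_free rise_mx.
Proof.
rewrite -kermx_eq0; apply/eqP/row_matrixP => i; rewrite row0.
have : row i (kermx rise_mx) *m rise_mx = 0 by apply/sub_kermxP/row_sub.
move: (row i _) => x xA.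
pose c j := Num.max (x 0 j) 0; pose d j := Num.max (- x 0 j) 0.
have xcd j : x 0 j = c j - d j by
  rewrite /c /d; case: lerP => h1; case: lerP => h2; lra.
have lev : level c =1 level d.
  move=> w; apply/eqP; rewrite -subr_eq0 /level -sumrB; apply/eqP.
  under eq_bigr => j _ do rewrite -mulrBl -xcd.
  have [wn|nw] := ltnP w n.-1.
    by have := level_rise_mx x (Ordinal wn); rewrite xA mxE.
  by rewrite big1 // => j _; rewrite rises_out ?mulr0 //; lia.
have c0 j : 0 <= c j by rewrite le_max lexx orbT.
have d0 j : 0 <= d j by rewrite le_max lexx orbT.
have cd j : c j * d j = 0.
  rewrite /c /d; case: lerP => h1; first by rewrite mul0r.
  by case: lerP => h2; rewrite ?mulr0 //; lra.
have dc j : d j * c j = 0 by rewrite mulrC.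
apply/rowP => j; rewrite xcd mxE (level_inj c0 d0 cd lev).
by rewrite (level_inj d0 c0 dc (fun w => esym (lev w))) subrr.
Qed.

(** With [N = n.-1], the [m] independent isotropic rows give [2 m <= 2 N - rank W], and
    [rank W >= N - 1]. *)
Lemma crossing_paths_bound : (m <= uphalf n.-1)%N.
Proof.
(* The skew form of a linear quiver: its kernel is at most a line, spanned by
   (1, 0, 1, 0, ...). *)
pose W : 'M[rat]_n.-1 := \matrix_(i, w) ((i.+1 == w)%:R - (i == w.+1 :> nat)%:R).
(* The neighbours missing at the two ends of the quiver count as 0: at the left by the [match], at
   the right by the condition on [f]. *)
have WE (f : nat -> rat) (w : 'I_n.-1) : f n.-1 = 0 ->
    \sum_(i < n.-1) f i * W i w = (if (w : nat) is w'.+1 then f w' else 0) - f w.+1.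
  move=> fn; under eq_bigr do rewrite mxE mulrBr; rewrite sumrB; congr (_ - _).
    case: w => -[|w] /= lt_w; first by rewrite big1 // => i _; rewrite mulr0.
    rewrite (bigD1 (Ordinal (ltnW lt_w))) //= eqxx mulr1 big1 ?addr0 // => i ni.
    by rewrite eqSS (negPf (_ : i != w :> nat)) ?mulr0.
  have [lt_w|] := ltnP w.+1 n.-1.
    rewrite (bigD1 (Ordinal lt_w)) //= eqxx mulr1 big1 ?addr0 // => i ni.
    by rewrite (negPf (_ : i != w.+1 :> nat)) ?mulr0.
  move=> le_w; have -> : w.+1 = n.-1 by have := ltn_ord w; lia.
  rewrite fn big1 // => i _; have := ltn_ord i.
  by case: eqP => [->|]; rewrite ?ltnn ?mulr0.
have AWA : rise_mx *m W *m rise_mx^T = 0.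
  apply/matrixP => j j'; rewrite !mxE.
  rewrite -[RHS](rises_isotropic (fun i => (i == j)%:R) j').
  apply: eq_bigr => w _; rewrite !mxE mulrC; congr (_ * _).
  have levj v : level (fun i => (i == j)%:R) v = (rises j v)%:R.
    rewrite /level (bigD1 j) //= eqxx mul1r big1 ?addr0 // => i /negPf->.
    by rewrite mul0r.
  under eq_bigr do rewrite [in X in X * _]mxE.
  rewrite (@WE (fun v => (rises j v)%:R)); last by rewrite rises_out //; lia.
  by rewrite levj /level_below; case: (w : nat) => // v; rewrite levj.
have rkA : \rank rise_mx = m by apply/eqP; apply: rise_mx_free.
have := mulmx0_rank_max AWA; rewrite mxrank_tr rkA.
have := mxrank_mul_min rise_mx W; rewrite rkA.
suff : (n.-1 <= (\rank W).+1)%N by move: (\rank _) (\rank _) => a b; lia.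
suff : (\rank (kermx W) <= 1)%N by rewrite mxrank_ker; lia.
case: (n.-1) W WE {AWA} => [|N] W WE; first by rewrite (leq_trans (rank_leq_row _)).
move: (kermx W) (mulmx_ker W) => K KW.
have -> : K = col 0 K *m \row_(w < N.+1) (~~ odd w)%:R.
  apply/matrixP => i w; rewrite mxE big_ord1 !mxE.
  pose u v := if (v < N.+1)%N then K i (inord v) else 0.
  have uE (v : 'I_N.+1) : u v = K i v by rewrite /u ltn_ord inord_val.
  (* A kernel row repeats with step 2, and the boundary value 0 forces [u 1 = 0]; so it is
     determined by [u 0]. *)
  have uW v : (v <= N)%N -> (if v is v'.+1 then u v' else 0) = u v.+1.
    rewrite -ltnS => lt_v; apply/eqP; rewrite -subr_eq0; apply/eqP.
    rewrite -(WE u (Ordinal lt_v)) ; last by rewrite /u ltnn.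
    have /matrixP/(_ i (Ordinal lt_v)) := KW; rewrite mxE [RHS]mxE => KW0.
    by rewrite -[RHS]KW0; apply: eq_bigr => w' _; rewrite -uE.
  suff ev v : (v <= N)%N -> u v = u 0%N * (~~ odd v)%:R.
    by rewrite -!uE ev // -ltnS.
  have [l] := ubnP v; elim: l v => // l IH [|[|v]] lv vN; first by rewrite mulr1.
    by rewrite mulr0 -(uW 0%N).
  rewrite -(uW v.+1); last exact: ltnW.
  by rewrite (IH v) /= ?negbK // ltnW // ltnW.
by apply: leq_trans (mxrankM_maxr _ _) (rank_leq_row _).
Qed.

End CrossingPaths.

(** * Coordinates of band modules *)

(** Indices are integers so that a path can also be read backwards. The field [path_prim] reflects
    that a band walk is not a proper power. *)
Record band_path (n r : nat) (h : int -> nat) : Prop := BandPath {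
  path_gt0 : (0 < r)%N;
  path_lt : forall p, (h p < n)%N;
  path_step : forall p, h (p + 1) = (h p).+1 \/ h p = (h (p + 1)).+1;
  path_per : forall p, h (p + r%:Z) = h p;
  path_prim : forall d : nat, (forall p, h (p + d%:Z) = h p) -> (r %| d)%N
}.

Lemma int_period (T : Type) (h : int -> T) (r : int) :
  (forall p, h (p + r) = h p) -> forall p c, h (p + c * r) = h p.
Proof.
move=> hr p c; elim: c p => [|c IH|c IH] p; first by rewrite mul0r addr0.
  by rewrite intS mulrDl mul1r addrA IH hr.
by rewrite -(hr (p + _)) -(IH p); congr h; rewrite intS; ring.
Qed.

Lemma int_period_dvd (T : Type) (h : int -> T) (r p q : int) :
  (forall p, h (p + r) = h p) -> (r %| q - p)%Z -> h q = h p.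
Proof.
by move=> hr /dvdzP[c qp]; rewrite -(int_period hr p c) -qp addrC subrK.
Qed.

Lemma quasi_period (k : fieldType) (V : lmodType k) (lam : k) (v : int -> V)
    (r : int) : lam != 0 -> (forall p, v (p + r) = lam *: v p) ->
  forall p, v p = lam ^ (p %/ r)%Z *: v (p %% r)%Z.
Proof.
move=> lam0 vr p; rewrite [in LHS](divz_eq p r) addrC.
elim: (p %/ r)%Z (p %% r)%Z => {p} [|c IH|c IH] p.
- by rewrite mul0r addr0 expr0z scale1r.
- rewrite -exprnP exprS -scalerA exprnP -IH -vr; congr v.
  by rewrite intS; ring.
- apply: (scalerI lam0); rewrite scalerA -vr -exprz_inv -exprnP exprS.
  rewrite mulrA mulfV // mul1r exprnP exprz_inv -IH; congr v.
  by rewrite intS; ring.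
Qed.

Section Coordinates.

Variables (k : fieldType) (n : nat).
Implicit Types (M N : lambda_module k n).

(* The basis of a band module unrolled to the integers: moving by a full
   period multiplies by the parameter.  The arrows of type o go down along the
   path h in the direction of increasing indices, those of the other type in
   the direction of decreasing ones. *)
Record band_coords M (r : nat) (lam : k) (o : bool) (h : int -> nat)
    (e : int -> 'cV[k]_(mdim M)) (f : int -> 'rV[k]_(mdim M)) : Prop :=
  BandCoords {
  co_idem : forall v p, idem M v *m e p = if v == h p :> nat then e p else 0;
  co_fwd : forall i p, act M (i, o) *m e p =
    if (h p == i.+1) && (h (p + 1) == i) then e (p + 1) else 0;
  co_bwd : forall i p, act M (i, ~~ o) *m e p =
    if (h p == i.+1) && (h (p - 1) == i) then e (p - 1) else 0;
  co_per : forall p, e (p + r%:Z) = lam *: e p;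
  co_dual : exists g : int -> k, [/\ g 0 = 1,
    forall d, ~~ (r%:Z %| d)%Z -> g d = 0
    & forall p q, f p *m e q = (g (q - p))%:M];
  co_span : forall (d : nat) (X Y : 'M_(d, mdim M)),
    (forall p, X *m e p = Y *m e p) -> X = Y
}.

(** Reading the band backwards exchanges the two types of arrows and inverts the parameter; this
    allows the type to be normalised to [false]. *)
Lemma coords_rev M r lam o h e f : lam != 0 ->
  band_coords (M := M) r lam o h e f ->
  band_coords (M := M) r lam^-1 (~~ o) (fun p => h (- p)) (fun p => e (- p))
    (fun p => f (- p)).
Proof.
move=> lam0 [idemE fwd bwd per [g [g0 gr fe]] span]; split.
- by move=> v p; rewrite idemE.
- by move=> i p; rewrite bwd opprD.
- by move=> i p; rewrite negbK fwd opprB addrC.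
- by move=> p; rewrite -[in RHS](subrK r%:Z (- p)) per scalerK // opprD.
- exists (fun d => g (- d)); rewrite oppr0; split=> // [d rd|p q].
    by rewrite gr // dvdzE abszN -dvdzE.
  by rewrite fe opprB opprK addrC.
- by move=> d X Y XY; apply: span => p; rewrite -(opprK p) XY.
Qed.

Lemma coords_shift M r lam o h e f c :
  band_coords (M := M) r lam o h e f ->
  band_coords (M := M) r lam o (fun p => h (p + c)) (fun p => e (p + c))
    (fun p => f (p + c)).
Proof.
move=> [idemE fwd bwd per [g [g0 gr fe]] span]; split.
- by move=> v p; rewrite idemE.
- by move=> i p; rewrite fwd addrAC.
- by move=> i p; rewrite bwd addrAC.
- by move=> p; rewrite -per addrAC.
- exists g; split=> // p q; rewrite fe; congr (g _)%:M; ring.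
- by move=> d X Y XY; apply: span => p; rewrite -(subrK c p) XY.
Qed.

Lemma coords_iso M N r lam o h e f : mod_iso M N ->
  band_coords (M := N) r lam o h e f ->
  exists e' f', band_coords (M := M) r lam o h e' f'.
Proof.
move=> [X [Y [[Xi Xa] [Yi Ya] YX XY]]] [idemE fwd bwd per [g [g0 gr fe]] span].
exists (fun p => Y *m e p), (fun p => f p *m X); split.
- by move=> v p; rewrite mulmxA -Yi -mulmxA idemE; case: eqP; rewrite ?mulmx0.
- by move=> i p; rewrite mulmxA -Ya -mulmxA fwd; case: andP; rewrite ?mulmx0.
- by move=> i p; rewrite mulmxA -Ya -mulmxA bwd; case: andP; rewrite ?mulmx0.
- by move=> p; rewrite per -scalemxAr.
- by exists g; split=> // p q; rewrite mulmxA -(mulmxA _ X) XY mulmx1 fe.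
- move=> d A B AB; rewrite -[A]mulmx1 -[B]mulmx1 -YX !mulmxA; congr (_ *m _).
  by apply: span => p; rewrite -!mulmxA.
Qed.

Section OneModule.

Variables (M : lambda_module k n) (r : nat) (lam : k) (o : bool).
Variables (h : int -> nat) (e : int -> 'cV[k]_(mdim M)).
Variable f : int -> 'rV[k]_(mdim M).
Hypothesis path_h : band_path n r h.
Hypothesis co : band_coords r lam o h e f.

(** Tested on each [e q]: both sides vanish unless [q] is congruent to [p - 1] modulo [r], and then
    periodicity makes the two height conditions the same. *)
Lemma co_fwd_dual i p : f p *m act M (i, o) =
  if (h p == i) && (h (p - 1) == i.+1) then f (p - 1) else 0.
Proof.
have [g [g0 gr fe]] := co_dual co; apply: (co_span co) => q.
rewrite -mulmxA (co_fwd co); have [rd|nrd] := boolP (r%:Z %| q - (p - 1))%Z.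
  rewrite (int_period_dvd (path_per path_h) rd).
  rewrite (@int_period_dvd _ _ _ p (q + 1) (path_per path_h)); last first.
    by rewrite (_ : q + 1 - p = q - (p - 1)) //; ring.
  rewrite andbC; case: ifP => _; rewrite ?mulmx0 ?mul0mx // !fe.
  by congr (g _)%:M; ring.
have -> : (if (h p == i) && (h (p - 1) == i.+1) then f (p - 1) else 0) *m e q = 0.
  by case: ifP => _; rewrite ?mul0mx // fe gr // raddf0.
case: ifP => _; rewrite ?mulmx0 // fe gr ?raddf0 //.
by rewrite (_ : q + 1 - p = q - (p - 1)) //; ring.
Qed.

Lemma co_bwd_dual i p : f p *m act M (i, ~~ o) =
  if (h p == i) && (h (p + 1) == i.+1) then f (p + 1) else 0.
Proof.
have [g [g0 gr fe]] := co_dual co; apply: (co_span co) => q.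
rewrite -mulmxA (co_bwd co); have [rd|nrd] := boolP (r%:Z %| q - (p + 1))%Z.
  rewrite (int_period_dvd (path_per path_h) rd).
  rewrite (@int_period_dvd _ _ _ p (q - 1) (path_per path_h)); last first.
    by rewrite (_ : q - 1 - p = q - (p + 1)) //; ring.
  rewrite andbC; case: ifP => _; rewrite ?mulmx0 ?mul0mx // !fe.
  by congr (g _)%:M; ring.
have -> : (if (h p == i) && (h (p + 1) == i.+1) then f (p + 1) else 0) *m e q = 0.
  by case: ifP => _; rewrite ?mul0mx // fe gr // raddf0.
case: ifP => _; rewrite ?mulmx0 // fe gr ?raddf0 //.
by rewrite (_ : q - 1 - p = q - (p + 1)) //; ring.
Qed.

Lemma co_idem_dual v p : f p *m idem M v = if v == h p :> nat then f p else 0.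
Proof.
have [g [g0 gr fe]] := co_dual co; apply: (co_span co) => q.
rewrite -mulmxA (co_idem co); have [rd|nrd] := boolP (r%:Z %| q - p)%Z.
  rewrite (int_period_dvd (path_per path_h) rd).
  by case: eqP; rewrite ?mulmx0 ?mul0mx.
by do 2! case: eqP => _; rewrite ?mulmx0 ?mul0mx // fe gr // raddf0.
Qed.

Lemma modz_ord p : exists i : 'I_r, (p %% r%:Z)%Z = i%:Z.
Proof.
have r0 := path_gt0 path_h.
have lt : (`|(p %% r%:Z)%Z| < r)%N.
  by rewrite -ltz_nat gez0_abs ?modz_ge0 ?ltz_pmod // -?lt0n_neq0 //; lia.
by exists (Ordinal lt); rewrite /= gez0_abs // modz_ge0 //; lia.
Qed.

Lemma co_dual_ord (i j : 'I_r) : f i%:Z *m e j%:Z = (i == j)%:R%:M.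
Proof.
have [g [g0 gr ->]] := co_dual co; congr _%:M.
have [->|ne] := eqVneq i j; first by rewrite subrr.
apply: gr; apply/negP => /dvdzP[c ec]; move/eqP: ne; apply; apply: val_inj => /=.
by have := ltn_ord i; have := ltn_ord j; case: c ec => [[|c]|[|c]]; nia.
Qed.

Lemma co_span_ord (d : nat) (X Y : 'M_(d, mdim M)) : lam != 0 ->
  (forall p : 'I_r, X *m e p%:Z = Y *m e p%:Z) -> X = Y.
Proof.
move=> lam0 XY; apply: (co_span co) => p; rewrite (quasi_period lam0 (co_per co)).
by have [i ->] := modz_ord p; rewrite -!scalemxAr XY.
Qed.

(** The map is prescribed on one period of the basis; having the same parameter, [v] and [e] then
    correspond at all indices. *)
Lemma co_transfer (d : nat) (v : int -> 'cV[k]_d) q : lam != 0 ->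
  (forall p, v (p + r%:Z) = lam *: v p) ->
  (\sum_(p < r) v p%:Z *m f p%:Z) *m e q = v q.
Proof.
move=> lam0 vr; rewrite (quasi_period lam0 (co_per co)) (quasi_period lam0 vr).
have [i ->] := modz_ord q; rewrite -scalemxAr mulmx_suml (bigD1 i) //=.
rewrite -mulmxA co_dual_ord eqxx mulmx1 big1 ?addr0 // => j ne.
by rewrite -mulmxA co_dual_ord (negPf ne) raddf0 mulmx0.
Qed.

Lemma co_sum : lam != 0 -> \sum_(p < r) e p%:Z *m f p%:Z = 1%:M.
Proof.
move=> lam0; apply: (co_span co) => p.
by rewrite co_transfer ?mul1mx //; apply: (co_per co).
Qed.

End OneModule.

Lemma coords_hom M N r lam o h e f e' f' X :
  band_coords (M := M) r lam o h e f -> band_coords (M := N) r lam o h e' f' ->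
  (forall p, X *m e p = e' p) -> is_hom (M := M) (N := N) X.
Proof.
move=> co co' Xe; split=> [v|[i b]]; apply: (co_span co) => p.
  rewrite -!mulmxA (co_idem co) Xe (co_idem co').
  by case: eqP; rewrite ?mulmx0.
rewrite -!mulmxA Xe; have [->|] := eqVneq b o.
  by rewrite (co_fwd co) (co_fwd co'); case: andP; rewrite ?mulmx0.
move=> ne; have -> : b = ~~ o by move: ne; clear; case: b; case: o.
by rewrite (co_bwd co) (co_bwd co'); case: andP; rewrite ?mulmx0.
Qed.

Lemma coords_mod_iso M N r lam o h e f e' f' : lam != 0 -> band_path n r h ->
  band_coords (M := M) r lam o h e f -> band_coords (M := N) r lam o h e' f' ->
  mod_iso M N.
Proof.
move=> lam0 ph co co'.
pose X := \sum_(p < r) e' p%:Z *m f p%:Z.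
pose Y := \sum_(p < r) e p%:Z *m f' p%:Z.
have Xe p : X *m e p = e' p by apply: (co_transfer ph co) (co_per co').
have Ye p : Y *m e' p = e p by apply: (co_transfer ph co') (co_per co).
exists X, Y; split; [exact: coords_hom co co' Xe|exact: coords_hom co' co Ye| |].
  by apply: (co_span co) => p; rewrite -mulmxA Xe Ye mul1mx.
by apply: (co_span co') => p; rewrite -mulmxA Ye Xe mul1mx.
Qed.

(* The steps from p to p + l form a factor string of M and a substring of N, and
   X sends the first one to the second one. *)
Lemma graph_map M N r lam h e f r' lam' h' e' f' o (p q : int) (l : nat) :
  band_path n r h -> band_path n r' h' ->
  band_coords (M := M) r lam o h e f ->
  band_coords (M := N) r' lam' o h' e' f' ->
  h p = (h (p - 1)).+1 -> h' (q - 1) = (h' q).+1 ->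
  (forall i : nat, (i <= l)%N -> h (p + i%:Z) = h' (q + i%:Z)) ->
  h (p + l%:Z) = (h (p + l%:Z + 1)).+1 ->
  h' (q + l%:Z + 1) = (h' (q + l%:Z)).+1 ->
  exists2 X, is_hom (M := M) (N := N) X & f' q *m X *m e p = 1%:M.
Proof.
move=> ph ph' co co' up dn agree dn2 up2.
pose X := \sum_(i < l.+1) e' (q + i%:Z) *m f (p + i%:Z); exists X.
  split=> [v|[i0 b]].
    rewrite /X mulmx_suml mulmx_sumr; apply: eq_bigr => i _.
    rewrite -mulmxA (co_idem_dual ph co) mulmxA (co_idem co').
    by rewrite agree -1?ltnS //; case: eqP; rewrite ?mulmx0 ?mul0mx.
  have pS (s : int) (j : nat) : s + j.+1%:Z = s + j%:Z + 1.
    by rewrite -addn1 PoszD addrA.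
  (* The two sums match after a shift of the index by one. The unmatched end terms vanish, by [up]
     and [up2] for type [o] and by [dn] and [dn2] for the other type. *)
  rewrite /X mulmx_suml mulmx_sumr; have [->|ne] := eqVneq b o.
    rewrite big_ord_recl [RHS]big_ord_recr /= !addr0.
    rewrite -mulmxA (co_fwd_dual ph co) mulmxA (co_fwd co') up up2.
    rewrite [X in if X then f _ else _](_ : _ = false); last by lia.
    rewrite [X in if X then e' _ else _](_ : _ = false); last by lia.
    rewrite mulmx0 mul0mx add0r addr0; apply: eq_bigr => i _.
    rewrite /bump /= add1n -mulmxA (co_fwd_dual ph co) mulmxA (co_fwd co').
    rewrite !(pS p) !(pS q) !addrK -(pS p i) -(pS q i) !agree ?ltn_ord ?ltnS
      ?(ltnW (ltn_ord i)) //.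
    by rewrite andbC; case: ifP => _; rewrite ?mulmx0 ?mul0mx.
  have -> : b = ~~ o by move: ne; clear; case: b; case: o.
  rewrite big_ord_recr [RHS]big_ord_recl /= !addr0.
  rewrite -mulmxA (co_bwd_dual ph co) mulmxA (co_bwd co') dn dn2.
  rewrite [X in if X then f _ else _](_ : _ = false); last by lia.
  rewrite [X in if X then e' _ else _](_ : _ = false); last by lia.
  rewrite mulmx0 mul0mx add0r addr0; apply: eq_bigr => i _.
  rewrite /bump /= add1n -mulmxA (co_bwd_dual ph co) mulmxA (co_bwd co').
  rewrite !(pS p) !(pS q) !addrK -(pS p i) -(pS q i).
  rewrite !agree ?ltn_ord ?(ltnW (ltn_ord i)) //.
  by rewrite andbC; case: ifP => _; rewrite ?mulmx0 ?mul0mx.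
have [g [g0 gr fe]] := co_dual co; have [g' [g0' gr' fe']] := co_dual co'.
rewrite /X mulmx_sumr mulmx_suml big_ord_recl big1 /= => [|i _].
  rewrite addr0 !addr0 mulmxA -mulmxA fe fe' !subrr g0 g0'.
  by rewrite mulmx1.
rewrite /bump /= add1n mulmxA -mulmxA fe fe' addrAC subrr add0r.
(* A further term survives only if both periods divide [i.+1]. Then the two end points after the
   stretch could be moved back into it, where the paths agree, although one path leaves downwards
   and the other upwards. *)
have [rd'|/gr'->] := boolP (r' %| i.+1%:Z)%Z; last by rewrite raddf0 mul0mx.
have [rd|/gr->] := boolP (r %| p - (p + i.+1%:Z))%Z; last first.
  by rewrite raddf0 mulmx0.
exfalso; move: up2 dn2.
have lt_i := ltn_ord i.
have E (s : int) : s + l%:Z + 1 = s + (l - i)%:Z + i.+1%:Z by rewrite -subzn; lia.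
rewrite (@int_period_dvd _ h' r' (q + (l - i)%:Z) _ (path_per ph')); last first.
  by rewrite E addrAC subrr add0r.
rewrite (@int_period_dvd _ h r (p + (l - i)%:Z) (p + l%:Z + 1) (path_per ph)).
  by rewrite !agree ?leq_subr //; lia.
rewrite E addrAC subrr add0r; move: rd.
by rewrite opprD addrA subrr add0r !dvdzE abszN.
Qed.

End Coordinates.

(** * The lattice path of a band walk *)

Section BandPath.

Variables (n : nat) (z : band_walk n).
Local Notation r := (size z).
Local Notation gam := (tnth (in_tuple z)).

Lemma size_band_gt0 : (0 < r)%N.
Proof. by case: (bw_band z). Qed.

Lemma size_band_neq0 : r%:Z != 0.
Proof. by rewrite -lt0n; apply: size_band_gt0. Qed.

(* Along a string either all the alphas go down and all the betas go up, or
   the other way round. *)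
Definition letter_type (g : letter n) : bool := g.1.2 (+) g.2.

(** Going straight on, the relations force the same label. At a turn, reducedness forces the other
    arrow of the pair, so label and direction change together. *)
Lemma string_step_type (g h : letter n) :
  string_step g h -> letter_type g = letter_type h.
Proof.
case: g h => [[i b] c] [[j b'] c'] /and3P[/eqP/(congr1 val)].
rewrite /letter_type /forbidden /in_R /linv /lsrc /ltgt.
case: c c' => [] [] /=; rewrite ?orbF ?addbT ?addbF.
- by move=> ->; rewrite eqxx /= => _ /negPn/eqP->.
- move=> [/val_inj->]; rewrite !xpair_eqE eqxx !andbT /= eq_sym.
  by move=> /eqP nb _; case: b b' nb => [] [].
- move=> /val_inj->; rewrite !xpair_eqE eqxx !andbT /= eq_sym.
  by move=> /eqP nb _; case: b b' nb => [] [].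
- by move=> ->; rewrite eqxx /= => _ /negPn/eqP->.
Qed.

Definition band_type : bool := letter_type (gam (Ordinal size_band_gt0)).

Lemma band_typeE s : letter_type (gam s) = band_type.
Proof.
case: s => s; elim: s => [|s IH] lt_s.
  by congr (letter_type (gam _)); apply: val_inj.
rewrite -(IH (ltnW lt_s)); apply/esym.
have -> : Ordinal lt_s = ordS (Ordinal (ltnW lt_s)).
  by apply: val_inj; rewrite /= modn_small.
exact/string_step_type/band_step.
Qed.

Definition band_height (p : int) : nat :=
  nth 0%N [seq nat_of_ord (lsrc g) | g <- z] `|(p %% r%:Z)%Z|%N.

Lemma band_divmod (i : 'I_r) (c : int) :
  ((i%:Z + c * r%:Z) %% r%:Z)%Z = i%:Z /\ ((i%:Z + c * r%:Z) %/ r%:Z)%Z = c.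
Proof.
have r0 := size_band_neq0.
have lt_i : 0 <= i%:Z < r%:Z by rewrite ltz_nat ltn_ord.
by rewrite [_ + _]addrC modzMDl divzMDl // modz_small // divz_small ?addr0.
Qed.

Lemma band_int_ord (p : int) : exists (i : 'I_r) c, p = i%:Z + c * r%:Z.
Proof.
have lt : (`|(p %% r%:Z)%Z| < r)%N.
  rewrite -ltz_nat gez0_abs ?modz_ge0 ?size_band_neq0 //.
  by rewrite ltz_pmod // ltz_nat size_band_gt0.
exists (Ordinal lt), (p %/ r%:Z)%Z.
by rewrite /= gez0_abs ?modz_ge0 ?size_band_neq0 // addrC -divz_eq.
Qed.

Lemma band_int_ordS (i : 'I_r) (c : int) : i%:Z + c * r%:Z + 1 =
  (ordS i)%:Z + (if i.+1 == r then c + 1 else c) * r%:Z.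
Proof.
rewrite /=; case: eqP => [ir|/eqP nir].
  by rewrite [X in (X %% _)%N]ir modnn mulrDl mul1r; lia.
rewrite modn_small; last by rewrite ltn_neqAle nir ltn_ord.
by rewrite intS; ring.
Qed.

Lemma band_heightE (i : 'I_r) c :
  band_height (i%:Z + c * r%:Z) = lsrc (gam i).
Proof.
rewrite /band_height (band_divmod i c).1 /= (nth_map (gam i)) //.
by rewrite [in RHS](tnth_nth (gam i)).
Qed.

Lemma band_heightSE (i : 'I_r) c :
  band_height (i%:Z + c * r%:Z + 1) = ltgt (gam i).
Proof. by rewrite band_int_ordS band_heightE -[lsrc _]/(band_vertex _) band_vertexS. Qed.

Lemma letter_eq (g g' : letter n) : letter_type g = letter_type g' ->
  lsrc g = lsrc g' :> nat -> ltgt g = ltgt g' :> nat -> g = g'.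
Proof.
case: g g' => [[i b] c] [[j b'] c']; rewrite /letter_type /lsrc /ltgt.
case: c c' => [] [] /=; rewrite ?addbT ?addbF => e; try lia.
  by move=> /val_inj-> _; rewrite (negb_inj e).
by move=> [/val_inj->] _; rewrite e.
Qed.

Lemma wpow_nth (x : letter n) (w : seq (letter n)) j i :
  (i < j * size w)%N -> nth x (wpow w j) i = nth x w (i %% size w).
Proof.
elim: j i => // j IH i; rewrite mulSn => lt_i.
have -> : wpow w j.+1 = w ++ wpow w j by [].
rewrite nth_cat; case: ltnP => [lt|le]; first by rewrite modn_small.
by rewrite IH ?ltn_subLR // -[in RHS](subnKC le) modnDl.
Qed.

Lemma size_wpow (w : seq (letter n)) j : size (wpow w j) = (j * size w)%N.
Proof.
elim: j => // j IH; have -> : wpow w j.+1 = w ++ wpow w j by [].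
by rewrite size_cat IH mulSn.
Qed.

Lemma band_path_height : band_path n r band_height.
Proof.
have per p : band_height (p + r%:Z) = band_height p.
  by rewrite /band_height -{1}(mul1r r%:Z) addrC modzMDl.
split=> //; first exact: size_band_gt0.
- by move=> p; have [i [c ->]] := band_int_ord p; rewrite band_heightE ltn_ord.
- move=> p; have [i [c ->]] := band_int_ord p.
  rewrite band_heightE band_heightSE /lsrc /ltgt.
  by case: ifP => _; [left|right].
(* By Bezout [g] is again a period; if it were smaller than [r], then [z] would be a proper power of
   its first [g] letters. *)
move=> d hd; pose g := gcdn d r.
have hg p : band_height (p + g%:Z) = band_height p.
  have [u [v E]] := Bezoutz d%:Z r%:Z.
  have -> : g%:Z = u * d%:Z + v * r%:Z by rewrite E.
  by rewrite addrA (int_period per) (int_period hd).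
have g_r : (g %| r)%N by apply: dvdn_gcdr.
have g_gt0 : (0 < g)%N by rewrite gcdn_gt0 size_band_gt0 orbT.
apply/gcdn_idPr; rewrite -/g; apply/eqP; rewrite eqn_leq dvdn_leq ?size_band_gt0 //=.
rewrite leqNgt; apply/negP => lt_g; have [_ str _ npow _] := bw_band z.
apply: npow; exists (take g z), (r %/ g)%N; split.
- apply/take_sorted; apply: sub_sorted str => x y; by case/and3P.
- by rewrite ltn_divRL // mul1n.
have sz : size (take g z) = g by rewrite size_take lt_g.
apply: (eq_from_nth (x0 := gam (Ordinal size_band_gt0))).
  by rewrite size_wpow sz divnK.
move=> i lt_i; rewrite wpow_nth sz ?divnK // nth_take ?ltn_pmod //.
have lt_m : (i %% g < r)%N by rewrite (leq_ltn_trans (leq_mod _ _)).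
have -> : nth (gam (Ordinal size_band_gt0)) z i = gam (Ordinal lt_i).
  by rewrite [in RHS](tnth_nth (gam (Ordinal size_band_gt0))).
have -> : nth (gam (Ordinal size_band_gt0)) z (i %% g) = gam (Ordinal lt_m).
  by rewrite [in RHS](tnth_nth (gam (Ordinal size_band_gt0))).
have E : i%:Z = (i %% g)%:Z + (i %/ g)%:Z * g%:Z.
  by rewrite -PoszM -PoszD addnC -divn_eq.
apply: letter_eq; first by rewrite !band_typeE.
  rewrite -!(band_heightE _ 0) /= !mul0r !addr0 E; exact: int_period.
by rewrite -!(band_heightSE _ 0) /= !mul0r !addr0 E addrAC; exact: int_period.
Qed.

End BandPath.

(** * Coordinates of the modules with Jordan blocks of size 1 *)

Section BandCoords.

Variables (k : fieldType) (n : nat) (z : band_walk n) (lam : k).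
Hypothesis lam0 : lam != 0.
Local Notation r := (size z).
Local Notation gam := (tnth (in_tuple z)).
Local Notation o := (band_type z).
Local Notation M := (band_module z 1 lam).

Definition band_eps (i : nat) : 'cV[k]_(\sum_(s < r) 1) :=
  \mxcol_(s < r) ((s == i :> nat)%:R%:M : 'M_1).

Definition band_phi (i : nat) : 'rV[k]_(\sum_(s < r) 1) :=
  \mxrow_(s < r) ((s == i :> nat)%:R%:M : 'M_1).

Definition band_e (p : int) : 'cV[k]_(mdim M) :=
  lam ^ (p %/ r%:Z)%Z *: band_eps `|(p %% r%:Z)%Z|%N.

(** The opposite exponent makes the pairing with [band_e] depend only on the difference of the
    indices, as [co_dual] demands. *)
Definition band_f (p : int) : 'rV[k]_(mdim M) :=
  lam ^ (- (p %/ r%:Z)%Z) *: band_phi `|(p %% r%:Z)%Z|%N.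

Lemma band_eE (i : 'I_r) c : band_e (i%:Z + c * r%:Z) = lam ^ c *: band_eps i.
Proof. by rewrite /band_e !(band_divmod i c).1 (band_divmod i c).2. Qed.

Definition wrap_factor (i : 'I_r) : k := if i.+1 == r then lam else 1.

Lemma wrap_factor_neq0 i : wrap_factor i != 0.
Proof. by rewrite /wrap_factor; case: ifP => _; rewrite ?oner_eq0. Qed.

Lemma band_eSE (i : 'I_r) c : band_e (i%:Z + c * r%:Z + 1) =
  lam ^ c *: (wrap_factor i *: band_eps (ordS i)).
Proof.
rewrite band_int_ordS band_eE /wrap_factor; case: eqP => _.
  by rewrite expfzDr // expr1z -scalerA.
by rewrite scale1r.
Qed.

Lemma jordan_block1 (a : k) : jordan_block 1 a = a%:M.
Proof. by apply/matrixP => i j; rewrite !mxE !ord1. Qed.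

Lemma mxblock_eps (B : 'I_r -> 'I_r -> 'M[k]_1) (j : 'I_r) :
  \mxblock_(i, l) B i l *m band_eps j = \mxcol_i B i j.
Proof.
rewrite mul_mxblock_mxrow; apply: eq_mxcol => i.
rewrite (bigD1 j) //= eqxx mulmx1 big1 ?addr0 // => l ne.
rewrite (_ : (l == j :> nat) = false) ?raddf0 ?mulmx0 //.
by apply/negP => /eqP/val_inj/eqP; apply/negP.
Qed.

Lemma mxcol_eps (a : k) (i : 'I_r) (B : 'I_r -> 'M[k]_1) :
  (forall l, B l = if l == i then a%:M else 0) ->
  \mxcol_l B l = a *: band_eps i.
Proof.
move=> HB; rewrite -mul_mx_scalar mxcol_mul; apply: eq_mxcol => l.
rewrite HB -val_eqE; case: eqP => _; first by rewrite mul1mx.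
by rewrite raddf0 mul0mx.
Qed.

Lemma band_act_fwd i0 (i : 'I_r) :
  act M (i0, o) *m band_eps i =
  if gam i == ((i0, o), false) then wrap_factor i *: band_eps (ordS i) else 0.
Proof.
rewrite [LHS]mxblock_eps /band_block.
(* Label xor direction equals [o] along the band, so an arrow labelled [o] is never traversed
   inversely. *)
have no l : (gam l == ((i0, o), true)) = false.
  apply/eqP => E; have := band_typeE l; rewrite E /letter_type /= addbT.
  by case: (o).
case: eqP => [E|_]; last first.
  by under eq_mxcol => l do rewrite /= no; rewrite mxcol0.
apply: mxcol_eps => l; rewrite no /wrap_factor jordan_block1 /=.
by case: eqP => // _; case: ifP.
Qed.

Lemma band_act_bwd i0 (i : 'I_r) :
  act M (i0, ~~ o) *m band_eps (ordS i) =
  if gam i == ((i0, ~~ o), true) then (wrap_factor i)^-1 *: band_eps i else 0.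
Proof.
rewrite [LHS]mxblock_eps /band_block.
have no l : (gam l == ((i0, ~~ o), false)) = false.
  apply/eqP => E; have := band_typeE l; rewrite E /letter_type /= addbF.
  by case: (o).
rewrite no /=; case: eqP => [E|ne]; last first.
  rewrite -[RHS](mxcol0 _ (p_ := fun _ => 1%N)); apply: eq_mxcol => l.
  rewrite (inj_eq (@ordS_inj _)).
  by case: eqP => //= E; case: eqP => // il; rewrite -il in E.
apply: mxcol_eps => l; rewrite (inj_eq (@ordS_inj _)) [i == l]eq_sym.
case: (l =P i) => [->|_]; last by rewrite andbF.
by rewrite E eqxx /wrap_factor /= jordan_block1; case: ifP; rewrite ?invr1.
Qed.

Lemma gam_fwd i0 (i : 'I_r) c : (gam i == ((i0, o), false)) =
  (band_height z (i%:Z + c * r%:Z) == i0.+1) &&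
  (band_height z (i%:Z + c * r%:Z + 1) == i0).
Proof.
rewrite band_heightE band_heightSE; apply/eqP/andP => [->|[/eqP h1 /eqP h2]].
  by rewrite /= !eqxx.
by apply: letter_eq; rewrite // band_typeE /letter_type addbF.
Qed.

Lemma gam_bwd i0 (i : 'I_r) c : (gam i == ((i0, ~~ o), true)) =
  (band_height z (i%:Z + c * r%:Z + 1) == i0.+1) &&
  (band_height z (i%:Z + c * r%:Z) == i0).
Proof.
rewrite band_heightE band_heightSE; apply/eqP/andP => [->|[/eqP h1 /eqP h2]].
  by rewrite /= !eqxx.
by apply: letter_eq; rewrite // band_typeE /letter_type addbT negbK.
Qed.

Lemma band_module_coords :
  band_coords (M := M) r lam o (band_height z) band_e band_f.
Proof.
split.
- move=> v p; have [i [c ->]] := band_int_ord z p.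
  rewrite band_eE band_heightE -scalemxAr.
  rewrite [_ *m _]mul_mxdiag_mxcol.
  rewrite (mxcol_eps (a := (v == lsrc (gam i))%:R) (i := i)) => [|l].
    by rewrite [v == _ :> nat]val_eqE; case: eqP; rewrite ?scale1r ?scale0r ?scaler0.
  rewrite (_ : (l == i :> nat) = (l == i)) //; case: (l =P i) => [->|_].
    by rewrite mulmx1 eq_sym; case: eqP; rewrite // raddf0.
  by rewrite (raddf0 (@scalar_mx k 1)) mulmx0.
- move=> i0 p; have [i [c ->]] := band_int_ord z p.
  rewrite band_eE band_eSE -gam_fwd -scalemxAr band_act_fwd.
  by case: eqP; rewrite ?scaler0.
- move=> i0 p; have [i [c ep]] := band_int_ord z (p - 1).
  have {ep}-> : p = i%:Z + c * r%:Z + 1 by rewrite -ep subrK.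
  rewrite addrK band_eE band_eSE -gam_bwd -!scalemxAr band_act_bwd.
  case: eqP; rewrite ?scaler0 // => _.
  by rewrite [wrap_factor i *: _]scalerA mulfV ?wrap_factor_neq0 // scale1r.
- move=> p; have [i [c ->]] := band_int_ord z p.
  rewrite -addrA -{2}(mul1r r%:Z) -mulrDl !band_eE scalerA.
  by rewrite addrC expfzDr // expr1z.
- exists (fun d => if (r%:Z %| d)%Z then lam ^ (d %/ r%:Z)%Z else 0); split.
  + by rewrite dvdz0 div0z expr0z.
  + by move=> d /negPf->.
  + move=> p q; have [i [c ->]] := band_int_ord z p.
    have [j [c' ->]] := band_int_ord z q.
    rewrite band_eE /band_f (band_divmod i c).1 (band_divmod i c).2 /=.
    rewrite -scalemxAl -scalemxAr scalerA -expfzDr // mul_mxrow_mxcol.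
    rewrite (bigD1 j) //= eqxx mulmx1 big1 ?addr0; last first.
      move=> l ne; rewrite (_ : (l == j :> nat) = false) ?raddf0 ?mulmx0 //.
      by apply/negP => /eqP/val_inj/eqP; apply/negP.
    have -> : (r%:Z %| j%:Z + c' * r%:Z - (i%:Z + c * r%:Z))%Z = (j == i).
      rewrite -eqz_mod_dvd (band_divmod i c).1 (band_divmod j c').1.
      by rewrite eqz_nat val_eqE.
    rewrite scale_scalar_mx; congr (_%:M).
    rewrite (_ : (j == i :> nat) = (j == i)) //.
    case: (j =P i) => [->|_]; last by rewrite mulr0.
    rewrite mulr1 addrC.
    rewrite (_ : i%:Z + _ - _ = (c' - c) * r%:Z); last by ring.
    by rewrite mulzK // size_band_neq0.
- move=> d X Y XY; rewrite -[X]submxrowK -[Y]submxrowK; apply: eq_mxrow => i.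
  have := XY i%:Z; have := band_eE i 0; rewrite mul0r addr0 expr0z scale1r => ->.
  rewrite -[X in X *m _ = _]submxrowK -[Y in _ = Y *m _]submxrowK.
  have E (A : 'M[k]_(d, \sum_(s < r) 1)) :
      \mxrow_j submxrow A j *m band_eps i = submxrow A i.
    rewrite mul_mxrow_mxcol (bigD1 i) //= eqxx mulmx1 big1 ?addr0 // => j ne.
    by rewrite [_ == _]val_eqE (negPf ne) raddf0 mulmx0.
  by rewrite !E.
Qed.

End BandCoords.

(** * The upper bound *)

(** Finite families suffice because a set that is infinite or has more than [b] elements contains
    [b.+1] distinct ones. *)
Lemma card_le_inj (T : Type) (A : set T) (b : nat) :
  (forall m (F : 'I_m -> T), injective F -> (forall i, A (F i)) -> (m <= b)%N) ->
  A #<= `I_b.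
Proof.
elim/Ppointed: T A => T A; first by rewrite emptyE => _; apply: card_ge0.
move=> leb; apply: contrapT => nle.
have : [set: 'I_b.+1] #<= A.
  rewrite -(card_le_eql card_II).
  have [/finite_setP[m Am]|/infiniteP infA] := pselect (finite_set A).
    rewrite (card_le_eqr Am) card_le_II ltnNge; apply/negP => mb; apply: nle.
    by rewrite (card_le_eql Am) card_le_II.
  exact: card_le_trans (card_leT _) infA.
case/pcard_leP => F; have := leb _ F; rewrite ltnn => H.
suff : false by []; apply: H => [x y|i].
  by apply: (@inj _ _ _ F); rewrite inE.
exact: (@funS _ _ _ _ F).
Qed.

Section Modules.

Variables (k : fieldType) (n : nat).
Implicit Types (M N P : lambda_module k n) (z : band_walk n).

Lemma mod_iso_sym M N : mod_iso M N -> mod_iso N M.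
Proof. by move=> [X [Y [hX hY YX XY]]]; exists Y, X. Qed.

Lemma is_hom_comp M N P X Y : is_hom (M := M) (N := N) X ->
  is_hom (M := N) (N := P) Y -> is_hom (M := M) (N := P) (Y *m X).
Proof.
move=> [Xi Xa] [Yi Ya]; split=> [v|a].
  by rewrite -mulmxA Xi mulmxA Yi mulmxA.
by rewrite -mulmxA Xa mulmxA Ya mulmxA.
Qed.

Lemma mod_iso_trans M N P : mod_iso M N -> mod_iso N P -> mod_iso M P.
Proof.
move=> [X [Y [hX hY YX XY]]] [X' [Y' [hX' hY' YX' XY']]].
exists (X' *m X), (Y *m Y'); split; [exact: is_hom_comp|exact: is_hom_comp| |].
  by rewrite mulmxA -(mulmxA Y) YX' mulmx1.
by rewrite mulmxA -(mulmxA X') XY mulmx1.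
Qed.

Lemma mod_iso_refl M : mod_iso M M.
Proof.
by exists 1%:M, 1%:M; split; rewrite ?mul1mx //; split=> *; rewrite mul1mx mulmx1.
Qed.

Lemma brick_iso M N X : mod_iso M N -> brick M -> is_hom (M := N) (N := N) X ->
  exists c : k, X = c%:M.
Proof.
move=> [Y [Y' [hY hY' YY' Y'Y]]] [_ bM] hX.
have [c E] := bM _ (is_hom_comp (is_hom_comp hY hX) hY').
exists c; have -> : X = Y *m (Y' *m (X *m Y)) *m Y'.
  by rewrite !mulmxA Y'Y mul1mx -mulmxA Y'Y mulmx1.
by rewrite E scalar_mxC -mulmxA Y'Y mulmx1.
Qed.

(* The Jordan nilpotent, repeated along the band, is an endomorphism. *)
Lemma band_brick_mult1 M z m lam : (0 < m)%N -> brick M ->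
  mod_iso M (band_module z m lam) -> m = 1%N.
Proof.
case: m => [|[|m]] // _ bM iM; exfalso.
pose J := jordan_block m.+2 (0 : k).
pose X : 'M_(mdim (band_module z m.+2 lam)) := \mxdiag_(s < size z) J.
have JJ a : J *m jordan_block m.+2 a = jordan_block m.+2 a *m J.
  have -> : jordan_block m.+2 a = a%:M + J.
    apply/matrixP => i j; rewrite !mxE; case: (i =P j) => _.
      by rewrite addr0.
    by rewrite mulr0n add0r.
  by rewrite mulmxDr mulmxDl scalar_mxC.
have hX : is_hom (M := band_module z m.+2 lam) (N := band_module z m.+2 lam) X.
  split=> [v|a].
    rewrite /X /= /band_idem mul_mxdiag_mxblock [RHS]mul_mxblock_mxdiag.
    apply: eq_mxblock => i j; case: eqP => [->|_]; last by rewrite mulmx0 mul0mx.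
    rewrite !conform_mx_id; case: eqP => _; first by rewrite mulmx1 mul1mx.
    by rewrite mulmx0 mul0mx.
  rewrite /X /= /band_act mul_mxdiag_mxblock [RHS]mul_mxblock_mxdiag.
  apply: eq_mxblock => i j; rewrite /band_block.
  by do ![case: ifP => _]; rewrite ?JJ ?mulmx1 ?mul1mx ?mulmx0 ?mul0mx.
have [c Xc] := brick_iso iM bM hX.
have := Xc; rewrite /X -mxdiagZ => /eq_mxdiagP/(_ (Ordinal (size_band_gt0 z))).
move/matrixP => /(_ ord0 (lift ord0 ord0)); rewrite !mxE /= mulr0n => /eqP.
by rewrite oner_eq0.
Qed.

(* The height of a band, read in the direction in which the alphas go down. *)
Definition height z (p : int) : nat := band_height z (if band_type z then - p else p).

Definition param z (lam : k) : k := if band_type z then lam^-1 else lam.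

Lemma paramK z : involutive (param z).
Proof. by move=> lam; rewrite /param; case: (band_type z); rewrite ?invrK. Qed.

Lemma param_neq0 z lam : lam != 0 -> param z lam != 0.
Proof. by rewrite /param; case: (band_type z); rewrite ?invr_eq0. Qed.

Lemma band_path_rev r h :
  band_path n r h -> band_path n r (fun p => h (- p)).
Proof.
case=> r0 lt st per prim; split=> //.
- move=> p; have := st (- p - 1); rewrite subrK opprD.
  by case; [right|left].
- by move=> p; rewrite opprD -[in RHS](subrK r%:Z (- p)) per.
- move=> d hd; apply: prim => p.
  by have := hd (- (p + d%:Z)); rewrite opprD !opprK addrK.
Qed.

Lemma path_height z : band_path n (size z) (height z).
Proof.
have := band_path_height z; rewrite /height; case: (band_type z) => // ph.
exact: band_path_rev.
Qed.

Lemma coords_height z lam : lam != 0 ->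
  exists e f, band_coords (M := band_module z 1 lam) (size z) (param z lam) false
    (height z) e f.
Proof.
move=> lam0; have := band_module_coords z lam0; rewrite /height /param.
case: (band_type z) => co; last by exists (band_e z lam), (band_f z lam).
by have := coords_rev lam0 co; eexists; eexists; eassumption.
Qed.

Lemma band_path_shift r h c : band_path n r h -> band_path n r (fun p => h (p + c)).
Proof.
case=> r0 lt st per prim; split=> //.
- by move=> p; rewrite addrAC; apply: st.
- by move=> p; rewrite addrAC; apply: per.
- by move=> d hd; apply: prim => p; have := hd (p - c); rewrite addrAC !subrK.
Qed.

(** Inversion is absorbed in [height] and cyclic conjugation in the offsets. Equal shifted paths
    have equal minimal periods, so both modules get coordinates on one path. *)
Lemma band_family_sub z z' p q :
  (forall t, height z (p + t) = height z' (q + t)) ->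
  band_family (k := k) z `<=` band_family z'.
Proof.
move=> E M [mu mu0 iM].
have lam0 := param_neq0 z mu0; have mu0' := param_neq0 z' lam0.
(* Chosen so that both modules have parameter [param z mu] once read in the normalised direction. *)
exists (param z' (param z mu)) => //; apply: mod_iso_trans iM _.
have [e [f co]] := coords_height z mu0.
have [e' [f' co']] := coords_height z' mu0'.
rewrite paramK in co'.
have hE t : height z (t + p) = height z' (t + q) by rewrite addrC E addrC.
have ph := band_path_shift p (path_height z).
have ph' := band_path_shift q (path_height z').
have rE : size z = size z'.
  apply/eqP; rewrite eqn_dvd; apply/andP; split.
    by apply: (path_prim ph) => t; rewrite !hE; apply: (path_per ph').
  by apply: (path_prim ph') => t; rewrite -!hE; apply: (path_per ph).
have {}co := coords_shift p co; have := coords_shift q co'.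
rewrite -(funext hE) -rE => {}co'; exact: coords_mod_iso lam0 ph co co'.
Qed.

Lemma band_brick_coords M : band_brick M -> exists z,
  band_family z M /\
  exists lam e f, band_coords (M := M) (size z) lam false (height z) e f.
Proof.
move=> [[z [m [lam [m0 lam0 iM]]]] bM].
have m1 := band_brick_mult1 m0 bM iM; rewrite {m}m1 in m0 iM *.
exists z; split; first by exists lam.
exists (param z lam); have [e [f co]] := coords_height z lam0.
exact: coords_iso iM co.
Qed.

Lemma crossing_hom M N r lam h e f r' lam' h' e' f' (p q l : nat) :
  band_path n r h -> band_path n r' h' ->
  band_coords (M := M) r lam false h e f ->
  band_coords (M := N) r' lam' false h' e' f' ->
  h p.+1%:Z = (h p%:Z).+1 -> h' q%:Z = (h' q.+1%:Z).+1 ->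
  (forall i, (i <= l)%N -> h (p.+1 + i)%N%:Z = h' (q.+1 + i)%N%:Z) ->
  h (p.+1 + l)%N%:Z = (h (p.+1 + l.+1)%N%:Z).+1 ->
  h' (q.+1 + l.+1)%N%:Z = (h' (q.+1 + l)%N%:Z).+1 ->
  exists2 X, is_hom (M := M) (N := N) X & f' q.+1%:Z *m X *m e p.+1%:Z = 1%:M.
Proof.
have S1 (s : nat) : s.+1%:Z - 1 = s%:Z by rewrite intS addrC addKr.
have Sl1 (s i : nat) : s%:Z + i%:Z + 1 = (s + i.+1)%N%:Z by rewrite addnS -addn1.
move=> ph ph' co co' up dn agree dn2 up2.
by apply: (graph_map (l := l) ph ph' co co'); rewrite ?S1 ?Sl1.
Qed.

Lemma compatible_bound (S : set (lambda_module k n)) :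
  compatible_band_bricks S -> S #<= `I_(uphalf n.-1).
Proof.
move=> [bS cS]; apply: card_le_inj => m F injF SF.
have [z Hz] := choice (fun j : 'I_m => band_brick_coords (bS _ (SF j))).
have ph j := path_height (z j).
apply: (@crossing_paths_bound m n (fun j => size (z j))
  (fun j p => height (z j) p%:Z)).
- by move=> j; apply: size_band_gt0.
- by move=> j p; rewrite PoszD (path_per (ph j)).
- by move=> j p; have := path_step (ph j) p; rewrite -PoszD addn1.
- by move=> j p; apply: path_lt (ph j) _.
- move=> j j' p q l up dn agree dn2 up2.
  have [_ [lam [e [f co]]]] := Hz j.
  have [ejj'|nejj'] := pselect (j = j'); last first.
    have [_ [lam' [e' [f' co']]]] := Hz j'.
    have [X hX fXe] := crossing_hom (ph j) (ph j') co co' up dn agree dn2 up2.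
    have [[/(_ X hX) X0 _] _] :=
      cS _ _ (SF j) (SF j') (fun E => nejj' (injF _ _ E)).
    move/matrixP: fXe => /(_ 0 0)/eqP.
    by rewrite X0 mulmx0 mul0mx !mxE eq_sym oner_eq0.
  (* On a brick the graph map is a scalar, so its coefficient is a multiple of [g] at the difference
     of the two positions. This is 0: if the period divided the difference, both stretches would
     continue alike. *)
  subst j'.
  have [X hX] := crossing_hom (ph j) (ph j) co co up dn agree dn2 up2.
  have [_ [_ /(_ X hX) [c ->]]] := bS _ (SF j).
  have [g [_ gr fe]] := co_dual co.
  rewrite mul_mx_scalar -scalemxAl fe gr; last first.
    apply/negP => rpq.
    have E i : height (z j) (p.+1 + i)%N%:Z = height (z j) (q.+1 + i)%N%:Z.
      apply: (int_period_dvd (path_per (ph j))); move: rpq.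
      by congr (_ %| _)%Z; rewrite !PoszD; ring.
    by move: dn2 up2; rewrite !E => ->; lia.
  by move/matrixP/(_ 0 0)/eqP; rewrite !mxE mul0rn mulr0 eq_sym oner_eq0.
- move=> j j' p q ne E.
  (* A negative [t] is made nonnegative by adding a large common multiple of the two periods. *)
  have ext t : height (z j) (p%:Z + t) = height (z j') (q%:Z + t).
    have r0 := size_band_gt0 (z j); have r0' := size_band_gt0 (z j').
    pose c := `|t|%N%:Z.
    have ge0 : 0 <= t + (c * (size (z j))%:Z) * (size (z j'))%:Z.
      have : c <= c * ((size (z j))%:Z * (size (z j'))%:Z).
        by rewrite ler_peMr // -PoszM lez_nat muln_gt0 r0.
      by rewrite -mulrA /c; lia.
    rewrite -(int_period (path_per (ph j)) _ (c * (size (z j'))%:Z)).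
    rewrite -(int_period (path_per (ph j')) _ (c * (size (z j))%:Z)).
    rewrite mulrAC -!addrA; case: (_ + _ * _) ge0 => // i _; exact: E.
  have [_ D] := cS _ _ (SF j) (SF j') (fun e => elimN eqP ne (injF _ _ e)).
  have [zj _] := Hz j; have [zj' _] := Hz j'.
  apply: (D (z j) (z j') zj zj'); apply/seteqP.
  split; first exact: band_family_sub ext.
  exact: (band_family_sub (fun t => esym (ext t))).
Qed.

End Modules.

(** * The Kronecker bands *)

Section Kronecker.

Variables (n : nat) (i : 'I_n.-1).

Definition kronecker_walk : seq (letter n) :=
  [:: ((i, false), false); ((i, true), true)].

Lemma kronecker_is_band : is_band kronecker_walk.
Proof.
have s1 : string_step ((i, false), false) ((i, true), true).
  by apply/and3P; split=> //; [apply/eqP/val_inj|apply/eqP].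
have s2 : string_step ((i, true), true) ((i, false), false).
  by apply/and3P; split=> //; [apply/eqP/val_inj|apply/eqP].
split=> //.
- by rewrite /is_string /= s1.
- exact/eqP/val_inj.
- move=> [w [j [_ j1 E]]]; have := congr1 size E; rewrite size_wpow /= => sz.
  have j2 : j = 2.
    have dj : (j %| 2)%N by apply/dvdnP; exists (size w); rewrite mulnC.
    by apply/eqP; rewrite eqn_leq j1 andbT (dvdn_leq _ dj).
  move: E sz; rewrite {j j1}j2; case: w => [|x [|y w]] // E; last by move=> /=; lia.
  move=> _.
  have E0 : ((i, false), false) = x by exact: (congr1 (head x) E).
  have E1 : ((i, true), true) = x by exact: (congr1 (last x) E).
  by have := congr1 snd (etrans E0 (esym E1)).
(* Prefixing the last letter of the walk makes the induction on the power uniform. *)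
move=> j; apply: (@path_sorted _ _ ((i, true), true)).
elim: j => //= j IH; exact/and3P.
Qed.

Definition kronecker : band_walk n := BandWalk kronecker_is_band.

Lemma height_kronecker p : height kronecker p =
  if (2 %| p)%Z then i.+1 else i.
Proof.
have ty : band_type kronecker = false by rewrite /band_type (tnth_nth ((i, true), true)).
rewrite /height ty /band_height /=; have := divz_eq p 2; set t := (p %% 2)%Z.
have : 0 <= t < 2 by rewrite modz_ge0 // ltz_pmod.
have -> : (2 %| p)%Z = (t == 0) by rewrite /t; apply/dvdz_mod0P/eqP.
by case: t => [[|[|?]]|?].
Qed.

Variables (k : fieldType) (lam : k).
Hypothesis lam0 : lam != 0.

(** The space at the upper vertex is the line of [e 0], on which an endomorphism is a scalar; the
    same scalar occurs on [e 1], the image of [e 0] under an arrow. *)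
Lemma kronecker_brick : brick (band_module kronecker 1 lam).
Proof.
split; first by rewrite /= big_const_ord.
move=> X [Xi Xa].
have [e [f co]] := coords_height kronecker lam0.
have ph := path_height kronecker.
have h0 : height kronecker 0 = i.+1 by rewrite height_kronecker.
have h1 : height kronecker 1 = i by rewrite height_kronecker.
have [g [g0 gr fe]] := co_dual co.
pose x := (f 0 *m X *m e 0) 0 0.
have sum : e 0 *m f 0 + e 1 *m f 1 = 1%:M.
  rewrite -(co_sum ph co (param_neq0 kronecker lam0)).
  by rewrite [RHS](@big_ord_recl _ _ _ 1) [X in _ = _ + X]big_ord1.
have Xe0 : X *m e 0 = x *: e 0.
  have ei : idem (band_module kronecker 1 lam) (src (i, false)) *m e 0 = e 0.
    by rewrite (co_idem co) h0 eqxx.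
  rewrite -ei mulmxA Xi -mulmxA -[X *m e 0]mul1mx -sum mulmxDl mulmxDr.
  rewrite -!mulmxA !(mulmxA (idem _ _)) !(co_idem co) h0 h1 /= eqxx.
  rewrite (_ : _ == _ = false); last by apply/eqP; lia.
  rewrite mul0mx addr0 (mulmxA (f 0)) [f 0 *m X *m e 0]mx11_scalar.
  by rewrite mul_mx_scalar.
have Xe1 : X *m e 1 = x *: e 1.
  have ae : act (band_module kronecker 1 lam) (i, false) *m e 0 = e 1.
    by rewrite (co_fwd co) add0r h0 h1 !eqxx.
  by rewrite -ae mulmxA Xa -mulmxA Xe0 -scalemxAr.
exists x; apply: (co_span_ord ph co (param_neq0 kronecker lam0)) => -[[|[|//]] lt] /=.
  by rewrite Xe0 mul_scalar_mx.
by rewrite Xe1 mul_scalar_mx.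
Qed.

End Kronecker.

(** * Compatibility of band bricks with disjoint supports *)

Section Disjoint.

Variables (k : fieldType) (n : nat).
Implicit Types (M N : lambda_module k n).

Lemma coords_idem0 M r lam o h e f (v : 'I_n) :
  band_coords (M := M) r lam o h e f -> (forall p, v <> h p :> nat) ->
  idem M v = 0.
Proof.
move=> co vh; apply: (co_span co) => p; rewrite mul0mx (co_idem co).
by case: eqP => // /vh.
Qed.

Lemma coords_idem_neq0 M r lam o h e f (v : 'I_n) p :
  band_coords (M := M) r lam o h e f -> v = h p :> nat -> idem M v != 0.
Proof.
move=> co vh; apply/eqP => v0; have := co_idem co v p.
rewrite v0 mul0mx vh eqxx => ep; have [g [g0 _ /(_ p p)]] := co_dual co.
rewrite -ep mulmx0 subrr g0 => /matrixP/(_ 0 0)/eqP.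
by rewrite !mxE eq_sym oner_eq0.
Qed.

Lemma hom_disjoint M N r lam o h e f X : band_path n r h ->
  band_coords (M := M) r lam o h e f ->
  (forall v : 'I_n, idem M v = 0 \/ idem N v = 0) ->
  is_hom (M := M) (N := N) X -> X = 0.
Proof.
move=> ph co MN [Xi _]; apply: (co_span co) => p; rewrite mul0mx.
pose v := Ordinal (path_lt ph p).
have ev : idem M v *m e p = e p by rewrite (co_idem co) eqxx.
have [v0|v0] := MN v; first by rewrite -ev v0 mul0mx mulmx0.
by rewrite -ev mulmxA Xi v0 !mul0mx.
Qed.

Lemma mod_iso_idem0 M N v : mod_iso M N -> idem N v = 0 -> idem M v = 0.
Proof.
move=> [X [Y [[Xi _] _ YX _]]] N0.
by rewrite -[idem M v]mul1mx -YX -mulmxA Xi N0 mul0mx mulmx0.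
Qed.

(** The idempotents of a band module do not involve its parameter, so the support is constant on a
    one-parameter family. *)
Lemma distinct_disjoint M N v :
  idem M v != 0 -> idem N v = 0 -> distinct_families M N.
Proof.
move=> Mv Nv z z' zM zN E; move: zM; rewrite E => -[mu _ iM].
have [mu' _ iN] := zN; case/eqP: Mv; apply: (mod_iso_idem0 iM).
exact: (mod_iso_idem0 (mod_iso_sym iN) Nv).
Qed.

Lemma even_edge_subproof (j : 'I_(uphalf n.-1)) : (j.*2 < n.-1)%N.
Proof. by have := ltn_ord j; lia. Qed.

Definition even_edge j : 'I_n.-1 := Ordinal (even_edge_subproof j).

Definition even_kronecker j := band_module (kronecker (even_edge j)) 1 (1 : k).

Lemma even_kronecker_idem j (v : 'I_n) :
  (idem (even_kronecker j) v == 0) = (v./2 != j).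
Proof.
have [e [f co]] := coords_height (kronecker (even_edge j)) (oner_neq0 k).
have [vj|vj] := eqVneq v./2 (j : nat).
  (* Position 0 is at the odd height [j.*2.+1] and position 1 at the even height [j.*2]. *)
  apply/negbTE/(coords_idem_neq0 (p := (~~ odd v)%:Z) co).
  by rewrite height_kronecker /= -vj; have := odd_double_half v; case: odd.
rewrite (coords_idem0 co) ?eqxx // => p; rewrite height_kronecker /=.
move/eqP: vj; case: ifP => _ vj E; apply: vj; rewrite E ?doubleK //.
by rewrite -[_.+1]/(true + _)%N half_bit_double.
Qed.

Lemma even_kronecker_compatible :
  compatible_band_bricks (range even_kronecker).
Proof.
have bb j : band_brick (even_kronecker j).
  split; last by apply: kronecker_brick; apply: oner_neq0.
  exists (kronecker (even_edge j)), 1%N, 1.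
  by split; rewrite ?oner_neq0 //; apply: mod_iso_refl.
split=> [M [j _ <-] //|M N [j _ <-] [j' _ <-] ne].
have disj v : idem (even_kronecker j) v = 0 \/ idem (even_kronecker j') v = 0.
  have [vj|/eqP] := eqVneq v./2 (j : nat).
    right; apply/eqP; rewrite even_kronecker_idem vj; apply/eqP => /val_inj jj'.
    by apply: ne; rewrite jj'.
  by move/eqP; rewrite -even_kronecker_idem => /eqP; left.
have [e [f co]] := coords_height (kronecker (even_edge j)) (oner_neq0 k).
have [e' [f' co']] := coords_height (kronecker (even_edge j')) (oner_neq0 k).
split; first split.
- by move=> X; apply: hom_disjoint (path_height _) co disj.
- by move=> X; apply: hom_disjoint (path_height _) co' _ => v; apply/or_comm/disj.
have nz : idem (even_kronecker j) (tgt (even_edge j, false)) != 0.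
  by rewrite even_kronecker_idem /= doubleK eqxx.
apply: (distinct_disjoint nz); case: (disj (tgt (even_edge j, false))) => // v0.
by rewrite v0 eqxx in nz.
Qed.

Lemma card_even_kronecker : range even_kronecker #= `I_(uphalf n.-1).
Proof.
apply: card_eq_trans (card_esym card_II).
apply: inj_card_eq => j j' _ _ E; apply/val_inj/eqP/contraT => nj.
have : idem (even_kronecker j') (tgt (even_edge j, false)) == 0.
  by rewrite even_kronecker_idem /= doubleK.
by rewrite -E even_kronecker_idem /= doubleK eqxx.
Qed.

End Disjoint.

Local Close Scope ring_scope.

(* uphalf n.-1 is the ceiling of (n - 1) / 2. *)
Theorem theorem6p7 (k : closedFieldType) (n : nat) (hn : (1 <= n)%N) :
  (exists S : set (lambda_module k n),
     compatible_band_bricks S /\ S #= `I_(uphalf n.-1)) /\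
  (forall S : set (lambda_module k n),
     compatible_band_bricks S -> S #<= `I_(uphalf n.-1)).
Proof.
split; last by move=> S; apply: compatible_bound.
exists (range (@even_kronecker k n)); split.
  exact: even_kronecker_compatible.
exact: card_even_kronecker.
Qed.
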